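(* The residue modulo $5$ of the statistic $\mathrm{stcrank}$ divides the partitions enumerated by $p_i(5n+4)$, $i=0,2$, into five equinumerous classes. That is, for every integer $n\ge 0$, every $i\in\{0,2\}$ and every $k\in\{0,1,2,3,4\}$, the number of partitions $\pi$ of $5n+4$ with $\mathrm{srank}(\pi)\equiv i\pmod 4$ and $\mathrm{stcrank}(\pi)\equiv k\pmod 5$ equals $\tfrac15\,p_i(5n+4)$.
   Context: A partition $\pi=(\lambda_1,\lambda_2,\lambda_3,\dots)$ is a nonincreasing sequence of nonnegative integers with finite sum $|\pi|=\lambda_1+\lambda_2+\cdots$; its parts are the positive $\lambda_j$, and $\pi$ is a partition of $|\pi|$. It is also written $\pi=(1^{f_1},2^{f_2},3^{f_3},\dots)$, where $f_j=f_j(\pi)$ is the number of times $j$ occurs as a part. The conjugate partition is $\pi'=(\lambda_1',\lambda_2',\dots)$ with $\lambda_j'=f_j+f_{j+1}+f_{j+2}+\cdots$. Stanley rank: $\mathrm{srank}(\pi)=\mathcal O(\pi)-\mathcal O(\pi')$, where $\mathcal O(\pi)$ is the number of odd parts of $\pi$ (counted with multiplicity). It is always even. For $i\in\{0,2\}$, $p_i(n)$ denotes the number of partitions $\pi$ of $n$ with $\mathrm{srank}(\pi)\equiv i\pmod 4$. Andrews-Garvan crank: let $\ell(\pi)$ be the largest part of $\pi$ (with $\ell=0$ for the empty partition), $\mu(\pi)$ the number of parts equal to $1$, and $\tilde\nu(\pi)$ the number of parts of $\pi$ larger than $\mu(\pi)$. Then $\mathrm{crank}(\pi)=\ell(\pi)$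 if $\mu(\pi)=0$, and $\mathrm{crank}(\pi)=\tilde\nu(\pi)-\mu(\pi)$ if $\mu(\pi)>0$. Bijection 1: to $\pi=(1^{f_1},2^{f_2},3^{f_3},\dots)$ associate the pair $(\pi_1,\pi_2)$ with $$\pi_1=(1^{\lfloor f_2/2\rfloor},2^{\lfloor f_4/2\rfloor},3^{\lfloor f_6/2\rfloor},\dots),\qquad \pi_2=(1^{f_1},2^{\{f_2\}},3^{f_3},4^{\{f_4\}},\dots),$$ where $\{x\}=x-2\lfloor x/2\rfloor$. (Thus $\pi_2$ has no repeated even parts.) Type B: a partition $\pi=(\lambda_1,\lambda_2,\dots)$ is of type B if and only if either (i) $|\pi|\neq4$, $\lambda_1-\lambda_2\ge2$, $\lambda_1'-\lambda_2'\ge2$, $\pi$ has no repeated even parts, and it is not the case that $\lambda_1-2$ and $\lambda_2$ are equal to the same even integer; or (ii) $\pi=(3,1)$. The stcrank: $\mathrm{stcrank}(\pi)=\mathrm{crank}(\pi_1)+\tfrac12\,\mathrm{srank}(\pi)+\Psi(\pi)$, where $\pi_1$ is the first component of the pair associated with $\pi$ by Bijection 1, and $\Psi(\pi)=1$ if $\pi$ is of type B and $\Psi(\pi)=0$ otherwise. *)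

(* Defs.v *)
From HB Require Import structures.
From mathcomp Require Import all_boot all_order all_algebra.
From mathcomp Require Import zify.

Set Implicit Arguments.
Unset Strict Implicit.
Unset Printing Implicit Defensive.

(* A partition is the sequence of its positive parts, in nonincreasing
   order; the trailing zeros of (lambda_1, lambda_2, ...) are dropped. *)
Definition is_partition (p : seq nat) : bool := sorted geq p && (0 \notin p).

Definition is_partition_of (n : nat) (p : seq nat) : bool :=
  is_partition p && (sumn p == n).

Structure intpartn (n : nat) : Type := IntPartn {
  intpartn_val :> seq nat;
  _ : is_partition_of n intpartn_val
}.

HB.instance Definition _ n := [isSub for @intpartn_val n].
HB.instance Definition _ n := [Countable of intpartn n by <:].

Lemma leq_sumn (s : seq nat) x : x \in s -> x <= sumn s.
Proof.
elim: s => //= y s IHs; rewrite inE => /predU1P[->|/IHs]; first exact: leq_addr.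
by move/leq_trans; apply; apply: leq_addl.
Qed.

Lemma size_leq_sumn (s : seq nat) : 0 \notin s -> size s <= sumn s.
Proof.
elim: s => //= y s IHs; rewrite inE negb_or eq_sym -lt0n => /andP[y0 /IHs h].
by rewrite -addn1 addnC leq_add.
Qed.

Definition intpartn_code n (p : intpartn n) : {bseq n of 'I_n.+1} :=
  insub_bseq n [seq inord x | x <- p].

Definition intpartn_decode n (b : {bseq n of 'I_n.+1}) : option (intpartn n) :=
  insub [seq val x | x <- b].

Lemma intpartn_codeK n : pcancel (@intpartn_code n) (@intpartn_decode n).
Proof.
move=> [p pP]; rewrite /intpartn_decode /intpartn_code /insub_bseq val_insubd.
have [/andP[_ p0] /eqP sp] := andP pP.
have sz : size p <= n by rewrite -sp size_leq_sumn.
rewrite /= size_map sz /=.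
suff -> : [seq nat_of_ord x | x <- [seq inord x : 'I_n.+1 | x <- p]] = p.
  by rewrite insubT.
rewrite -map_comp -[RHS]map_id; apply/eq_in_map => x xp /=.
by rewrite inordK // ltnS -sp leq_sumn.
Qed.

HB.instance Definition _ n : isFinite (intpartn n) :=
  PCanIsFinite (@intpartn_codeK n).

Definition largest (p : seq nat) : nat := head 0 p.

(* lambda_j, with j >= 1 *)
Definition part (p : seq nat) (j : nat) : nat := nth 0 p j.-1.

(* f_j *)
Definition mult (p : seq nat) (j : nat) : nat := count_mem j p.

(* (1^(f 1), 2^(f 2), ..., m^(f m)) *)
Definition of_mults (m : nat) (f : nat -> nat) : seq nat :=
  flatten [seq nseq (f j) j | j <- rev (iota 1 m)].

Definition conj_partition (p : seq nat) : seq nat :=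
  [seq \sum_(j <= i < (largest p).+1) mult p i | j <- iota 1 (largest p)].

Definition num_odd_parts (p : seq nat) : nat := count odd p.

Definition srank (p : seq nat) : int :=
  ((num_odd_parts p)%:Z - (num_odd_parts (conj_partition p))%:Z)%R.

Definition crank (p : seq nat) : int :=
  let mu := mult p 1 in
  let nu := count (fun x => mu < x) p in
  if mu == 0 then (largest p)%:Z%R else (nu%:Z - mu%:Z)%R.

(* All multiplicities vanish above the largest part of p. *)
Definition bijection1 (p : seq nat) : seq nat * seq nat :=
  (of_mults (largest p) (fun j => mult p j.*2 %/ 2),
   of_mults (largest p) (fun j => if odd j then mult p j else mult p j %% 2)).

Definition no_repeated_even_parts (p : seq nat) : bool :=
  all (fun x => odd x || (mult p x <= 1)) p.

Definition type_B (p : seq nat) : bool :=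
  [&& sumn p != 4,
      part p 2 + 2 <= part p 1,
      part (conj_partition p) 2 + 2 <= part (conj_partition p) 1,
      no_repeated_even_parts p
    & ~~ ((part p 1 - 2 == part p 2) && ~~ odd (part p 2))]
  || (p == [:: 3; 1]).

(* The division by 2 is exact: see srank_even. *)
Definition stcrank (p : seq nat) : int :=
  (crank (bijection1 p).1 + (srank p %/ 2)%Z + (type_B p : nat)%:Z)%R.

(* p_i(n) *)
Definition p_srank (i n : nat) : nat :=
  #|[set p : intpartn n | (srank p == i%:Z %[mod 4])%Z]|.

Lemma conj_partitionE (p : seq nat) : is_partition p ->
  conj_partition p = [seq count (leq j) p | j <- iota 1 (largest p)].
Proof.
move=> /andP[ps _]; apply: eq_map => j.
have : all (fun x => x < (largest p).+1) p.
  case: p ps => //= y s; rewrite (path_sortedE (rev_trans leq_trans)).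
  by case/andP=> /allP h _; rewrite ltnSn; apply/allP => x /h.
elim: p {ps} (largest p).+1 => [|x s IHs] m /=; first by rewrite big1.
case/andP=> xm /IHs <-; rewrite /mult big_split /=; congr (_ + _).
case: leqP => jx; last first.
  by rewrite big_nat big1 // => i /andP[ji _]; apply/eqP; rewrite eqb0; apply/eqP => /= xi; move: ji; rewrite -xi leqNgt jx.
rewrite (big_cat_nat (n := x)) //=; last exact: ltnW.
rewrite big_nat big1 ?add0n; last by move=> i /andP[_ ix]; apply/eqP; rewrite eqb0; apply/eqP => /= xi; rewrite xi ltnn in ix.
rewrite big_ltn // eqxx big_nat big1 ?addn0 // => i /andP[xi _].
by apply/eqP; rewrite eqb0; apply/eqP => /= e; rewrite e ltnn in xi.
Qed.

Lemma sumn_conj_partition (p : seq nat) :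
  is_partition p -> sumn (conj_partition p) = sumn p.
Proof.
move=> pP; rewrite conj_partitionE //; case/andP: pP => ps _.
have : all (fun x => x <= largest p) p.
  case: p ps => //= y s; rewrite (path_sortedE (rev_trans leq_trans)).
  by case/andP=> /allP h _; rewrite leqnn; apply/allP => x /h.
elim: p {ps} (largest p) => [|x s IHs] m /=.
  by move=> _; elim: (iota 1 m).
case/andP=> xm /IHs <-.
have {2}-> : x = sumn [seq (j <= x : nat) | j <- iota 1 m].
  rewrite sumn_count -(subnKC xm) iotaD count_cat.
  rewrite (eq_in_count (a2 := predT)); last by move=> j; rewrite mem_iota /= => /andP[]; lia.
  rewrite count_predT size_iota (eq_in_count (a2 := pred0)) ?count_pred0 ?addn0 //.
  by move=> j; rewrite mem_iota /= => /andP[]; lia.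
by elim: (iota 1 m) => //= j r IHr; lia.
Qed.

Lemma odd_num_odd_parts (s : seq nat) : odd (num_odd_parts s) = odd (sumn s).
Proof. by elim: s => //= x s IHs; rewrite !oddD IHs; case: (odd x). Qed.

Lemma srank_even (p : seq nat) : is_partition p -> (2 %| srank p)%Z.
Proof.
move=> pP; rewrite /srank.
have := odd_num_odd_parts (conj_partition p).
rewrite sumn_conj_partition // -odd_num_odd_parts; lia.
Qed.

(* Main.v *)
Require Import Defs.
From mathcomp Require Import all_boot all_order all_algebra.
From mathcomp Require Import all_field zify ring.

(** Fix a fifth root of unity [zeta != 1] and a number [e] with [e ^+ 2 = 1].
By orthogonality of roots of unity it suffices that
[zeta ^ stcrank p * e ^ (srank p / 2)] sums to zero over the partitions [p] of
[5 * n + 4] ([stcrank_sum]): running over all [zeta] and [e] isolates the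
residue of the stcrank mod 5 and that of the srank mod 4.

Bijection 1 takes pairs of equal even parts out of a partition.  A pair changes
neither the number of odd parts nor the parity of any column, so the srank only
sees the second component.  Put [t = e * zeta].  Without the correction [Psi],
the generating function is therefore the product of
- the crank generating function in [q ^+ 4], which is
  [prod_j (1 - q^4j) / ((1 - zeta q^4j) (1 - zeta^-1 q^4j))] except that the
  coefficient of [q ^+ 4] is off by [1 - zeta] ([crank_gf]);
- the generating function of half the srank over partitions without repeated
  even parts, which is the Andrews-Stanley product
  [prod_j (1 + q^(2j-1)) / ((1 - t q^(4j-2)) (1 - t^-1 q^(4j-2)))]
  ([gf_rows] and [distinct_rows_lim]).
The term [Psi] repairs the wrong coefficient: adding 2 to the largest part and
two new parts 1 preserves the srank and maps the partitions of [n] without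
repeated even parts onto the partitions of [n + 4] of type B ([sum_type_B]).

What remains is, with [Q = e * q ^+ 2],
[prod_j (1 - q^4j) (1 + q^(2j-1)) / prod_j (1 - zeta Q^j) (1 - zeta^-1 Q^j)].
Supplying the three missing factors of [1 - Q^5j] turns the denominator into a
series in [q ^+ 10], and by Jacobi's triple product the numerator becomes, up
to a constant,
[sum_d q^(2 d^2 + d) * sum_m (-1)^m (zeta^(2m) - zeta^(3m+3)) Q^(m(m+1)/2)]
with [d] over the integers and [m] over the naturals ([five_dissection]).
The exponent [2 d^2 + d + m (m + 1)] is 4 mod 5 only when [m] is 2 mod 5, and
then [zeta^(2m) = zeta^(3m+3)]; so no power [q^(5n+4)] survives
([vanishing_theta]).

All the series live in the ring [F[X] / (X^K)], where [q] is nilpotent: an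
infinite product is then one of its finite partial products, [1 - w] is a unit
for every nilpotent [w], and the identities hold exactly. *)

Set Implicit Arguments.
Unset Strict Implicit.
Unset Printing Implicit Defensive.

Import GRing.Theory.
Local Open Scope ring_scope.

(** * Products and sums in a nilpotent base *)

Section QSeries.

Variable A : comUnitRingType.
Implicit Types (a c u v x y P : A) (i j k l m n r K : nat).

Lemma expr_nil x K n : x ^+ K = 0 -> (K <= n)%N -> x ^+ n = 0.
Proof. by move=> x0 /subnKC <-; rewrite exprD x0 mul0r. Qed.

Lemma mul_nil a x K : x ^+ K = 0 -> (a * x) ^+ K = 0.
Proof. by move=> x0; rewrite exprMn x0 mulr0. Qed.

Lemma exp_nil x K n : x ^+ K = 0 -> (0 < n)%N -> (x ^+ n) ^+ K = 0.
Proof. by move=> x0 n0; rewrite -exprM (expr_nil x0) // leq_pmull. Qed.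

Lemma geom_nil x K : x ^+ K = 0 -> (1 - x) * (\sum_(i < K) x ^+ i) = 1.
Proof. by move=> x0; rewrite -opprB mulNr -subrX1 x0 sub0r opprK. Qed.

Lemma unit_sub_nil x K : x ^+ K = 0 -> 1 - x \is a GRing.unit.
Proof. by move=> /geom_nil h; apply/unitrPr; eexists; exact: h. Qed.

Lemma inv_sub_nil x K : x ^+ K = 0 -> (1 - x)^-1 = \sum_(i < K) x ^+ i.
Proof.
move=> x0; apply: (mulrI (unit_sub_nil x0)).
by rewrite (geom_nil x0) divrr // (unit_sub_nil x0).
Qed.

Definition qpoch a P n : A := \prod_(i < n) (1 - a * P ^+ i).

Lemma qpoch0 a P : qpoch a P 0 = 1.
Proof. by rewrite /qpoch big_ord0. Qed.

Lemma qpochS a P n : qpoch a P n.+1 = qpoch a P n * (1 - a * P ^+ n).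
Proof. by rewrite /qpoch big_ord_recr. Qed.

Lemma qpochSl a P n : qpoch a P n.+1 = (1 - a) * qpoch (a * P) P n.
Proof.
rewrite /qpoch big_ord_recl expr0 mulr1; congr (_ * _).
by apply: eq_bigr => i _; rewrite exprS mulrA.
Qed.

Lemma qpochD a P m n : qpoch a P (m + n) = qpoch a P m * qpoch (a * P ^+ m) P n.
Proof.
rewrite /qpoch big_split_ord; congr (_ * _).
by apply: eq_bigr => i _; rewrite exprD mulrA.
Qed.

Lemma qpoch_stable a P K n : P ^+ K = 0 -> (K <= n)%N -> qpoch a P n = qpoch a P K.
Proof.
move=> P0 /subnKC <-; rewrite qpochD P0 mulr0 [X in _ * X]big1 ?mulr1 //.
by move=> i _; rewrite mul0r subr0.
Qed.

Lemma qpoch_unit a P K n : a ^+ K = 0 -> qpoch a P n \is a GRing.unit.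
Proof.
move=> a0; rewrite unitr_prod //= => i _.
by apply: (@unit_sub_nil _ K); rewrite mulrC (mul_nil _ a0).
Qed.

(** The q-binomial theorem.  Both sides, as functions of [x], satisfy
[(1 - x) S x = (1 - a x) S (x P)]; iterating [K] times replaces the argument of
the sum by [x * P ^+ K = 0], where only the constant term is left. *)
Lemma qbinomial a x P K : P ^+ K = 0 -> x ^+ K = 0 ->
  qpoch x P K * (\sum_(i < K) qpoch a P i / qpoch P P i * x ^+ i)
  = qpoch (a * x) P K.
Proof.
move=> P0 x0; pose c i := qpoch a P i / qpoch P P i.
have cS i : c i.+1 * (1 - P ^+ i.+1) = c i * (1 - a * P ^+ i).
  have Pu n : qpoch P P n \is a GRing.unit by apply: qpoch_unit P0.
  rewrite /c; apply: (mulIr (Pu i)); rewrite -!mulrA [_ * qpoch P P i]mulrC.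
  rewrite [_ * qpoch P P i in RHS]mulrC.
  have -> : qpoch P P i * (1 - P ^+ i.+1) = qpoch P P i.+1 by rewrite qpochS exprS.
  by rewrite mulVr // mulr1 mulKr // qpochS.
pose S y := \sum_(i < K) c i * y ^+ i.
have SS y : y ^+ K = 0 -> (1 - y) * S y = (1 - a * y) * S (y * P).
  move=> y0; apply/eqP; rewrite -subr_eq0 /S !mulr_sumr -sumrB.
  pose g i := - (c i * (1 - P ^+ i) * y ^+ i).
  rewrite (eq_bigr (fun i : 'I_K => g i.+1 - g i)); last first.
    by move=> i _; rewrite /g cS exprMn exprS; ring.
  rewrite -(big_mkord xpredT (fun i => g i.+1 - g i)) telescope_sumr // /g.
  by rewrite y0 expr0 subrr !(mulr0, mul0r, subrr).
have iter n : qpoch x P n * S x = qpoch (a * x) P n * S (x * P ^+ n).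
  elim: n => [|n IH]; first by rewrite !qpoch0 !mul1r mulr1.
  rewrite !qpochS mulrAC IH -[LHS]mulrA -[RHS]mulrA; congr (_ * _).
  rewrite mulrC SS; last by rewrite mulrC mul_nil.
  by rewrite exprSr !mulrA.
rewrite -/(S x) iter P0 mulr0.
case: K P0 x0 @S {SS iter} => [|K] P0 x0 S.
  rewrite !qpoch0 mul1r; apply: contra_eq (oner_neq0 A); rewrite /S.
  by move: x0; rewrite expr0 => ->; rewrite big_ord0 eqxx.
rewrite /S big_ord_recl big1 ?addr0 => [|i _]; last by rewrite exprS mul0r mulr0.
by rewrite /c !qpoch0 divr1 !mulr1.
Qed.

(** Gaussian binomial coefficients, by the q-Pascal rule rather than as a quotient,
so that they make sense for every [P]. *)
Fixpoint gbin P n k : A :=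
  match n, k with
  | _, 0 => 1
  | 0, _.+1 => 0
  | n'.+1, k'.+1 => gbin P n' k' + P ^+ k * gbin P n' k
  end.

Lemma gbinn0 P n : gbin P n 0 = 1. Proof. by case: n. Qed.

Lemma gbinS P n k : gbin P n.+1 k.+1 = gbin P n k + P ^+ k.+1 * gbin P n k.+1.
Proof. by []. Qed.

Lemma gbin_small P n k : (n < k)%N -> gbin P n k = 0.
Proof.
by elim: n k => [|n IH] [|k] //= nk; rewrite !IH // ?mulr0 ?addr0 // ltnW.
Qed.

Lemma gbin_fact P n k : (k <= n)%N ->
  gbin P n k * qpoch P P k * qpoch P P (n - k) = qpoch P P n.
Proof.
elim: n k => [|n IH] [|k] kn; rewrite ?gbinn0 ?subn0 ?qpoch0 ?mul1r ?mulr1 //=.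
rewrite subSS mulrDl mulrDl [in RHS]qpochS -exprS.
have -> : gbin P n k * qpoch P P k.+1 * qpoch P P (n - k)
          = (1 - P ^+ k.+1) * qpoch P P n.
  by rewrite -(IH k) // qpochS -exprS; ring.
have [->|kn'] := eqVneq k n.
  rewrite gbin_small //; ring.
have lt_kn : (k < n)%N by rewrite ltn_neqAle kn'.
have -> : P ^+ k.+1 * gbin P n k.+1 * qpoch P P k.+1 * qpoch P P (n - k)
          = P ^+ k.+1 * (1 - P ^+ (n - k)) * qpoch P P n.
  rewrite -(IH k.+1) // (_ : n - k = (n - k.+1).+1)%N; last by lia.
  by rewrite [qpoch P P (n - k.+1).+1]qpochS -exprS; ring.
have -> : P ^+ n.+1 = P ^+ k.+1 * P ^+ (n - k).
  by rewrite -exprD; congr (_ ^+ _); lia.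
by ring.
Qed.

Lemma gbinS_alt P n k : (k <= n)%N ->
  gbin P n.+1 k.+1 = gbin P n k.+1 + P ^+ (n - k) * gbin P n k.
Proof.
elim: n k => [|n IH] k kn.
  by case: k kn => //= _; rewrite mulr0 addr0 add0r mulr1.
have [->|kn'] := eqVneq k n.+1.
  rewrite subnn [gbin P n.+1 n.+2]gbin_small // expr0 add0r mul1r.
  by rewrite gbinS [X in _ * X]gbin_small // mulr0 addr0.
have lt_kn : (k <= n)%N by rewrite -ltnS ltn_neqAle kn'.
case: k kn {kn'} lt_kn => [|k] kn lt_kn.
  rewrite gbinS [X in _ * X]IH // gbinS !gbinn0 !subn0.
  by rewrite [P ^+ n.+1]exprS expr1; ring.
rewrite gbinS [X in _ * X]IH // [in LHS](IH k) ?(ltnW lt_kn) //.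
rewrite [gbin P n.+1 k.+2]gbinS [X in _ = _ + _ * X]gbinS.
rewrite subSS (_ : n - k = (n - k.+1).+1)%N; last by lia.
have -> : P ^+ k.+2 * (gbin P n k.+2 + P ^+ (n - k.+1) * gbin P n k.+1)
   = P ^+ k.+2 * gbin P n k.+2 + P ^+ (n - k.+1).+1 * (P ^+ k.+1 * gbin P n k.+1).
  by rewrite !exprS; ring.
by ring.
Qed.

Arguments gbin : simpl never.

(** Far from the right end of a long row, a Gaussian binomial coefficient is the
inverse of a q-factorial. *)
Lemma gbin_lim P K n k : P ^+ K = 0 -> (k + K <= n)%N ->
  gbin P n k * qpoch P P k = 1.
Proof.
move=> P0 kKn; have Ku : qpoch P P K \is a GRing.unit by apply: qpoch_unit P0.
apply: (mulIr Ku); rewrite mul1r.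
rewrite -{1}(@qpoch_stable P P K (n - k)) //; last by lia.
by rewrite gbin_fact ?(@qpoch_stable P P K n) //; lia.
Qed.

(** The [r]-th term of a finite triple product whose index is shifted by [j] to
stay a natural number: the exponent of [u], resp. [v], is [r - j], resp. [j - r],
and both branches come from one two-sided sequence since [u * v] is the base. *)
Definition theta_term u v j r : A :=
  if (j <= r)%N then u ^+ (r - j) * (u * v) ^+ 'C(r - j, 2)
  else v ^+ (j - r) * (u * v) ^+ 'C(j - r, 2).

(** The induction base of the finite triple product: no factors in [u]. *)
Lemma rothe P v j :
  \prod_(l < j) (1 + v * P ^+ l)
  = \sum_(r < j.+1) gbin P j r * (v ^+ (j - r) * P ^+ 'C(j - r, 2)).
Proof.
elim: j => [|j IH].
  by rewrite big_ord0 big_ord_recl big_ord0 gbinn0 !mulr1 addr0.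
pose w d := v ^+ d * P ^+ 'C(d, 2); rewrite -/(w _) in IH *.
rewrite big_ord_recr IH /= mulrDr mulr1.
rewrite [RHS](eq_bigr (fun r : 'I_j.+2 => gbin P j.+1 r * w (j.+1 - r)%N)) //.
rewrite [RHS]big_ord_recl subn0 gbinn0 mul1r.
rewrite [X in _ = _ + X](eq_bigr (fun r : 'I_j.+1 => gbin P j r * w (j - r)%N +
    P ^+ r.+1 * gbin P j r.+1 * w (j - r)%N)); last first.
  by move=> r _; rewrite /= /bump add1n subSS mulrDl.
rewrite big_split /= addrCA; congr (_ + _).
rewrite mulr_suml [X in _ + X]big_ord_recr /= gbin_small // mulr0 mul0r addr0.
rewrite big_ord_recl subn0 gbinn0 mul1r; congr (_ + _).
  by rewrite /w binS bin1 exprD exprSr; ring.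
apply: eq_bigr => r _; rewrite /bump ?add1n /w.
have -> : (j - r = (j - r.+1).+1)%N by have := ltn_ord r; lia.
rewrite binS bin1 exprD.
have -> : P ^+ j = P ^+ r.+1 * P ^+ (j - r.+1).
  by rewrite -exprD; congr (_ ^+ _); have := ltn_ord r; lia.
by rewrite [v ^+ _.+1]exprSr; ring.
Qed.

(** Multiplying the [r]-th term by [u * P ^+ i] gives [P ^+ (i + j - r)] times the
next term, which is what the second q-Pascal rule asks for. *)
Lemma finite_triple_product u v i j :
  (\prod_(l < i) (1 + u * (u * v) ^+ l)) * (\prod_(l < j) (1 + v * (u * v) ^+ l))
  = \sum_(r < (i + j).+1) gbin (u * v) (i + j) r * theta_term u v j r.
Proof.
set P := u * v; elim: i => [|i IH].
  rewrite big_ord0 mul1r add0n rothe; apply: eq_bigr => r _.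
  rewrite /theta_term; case: leqP => // jr.
  have -> : (r : nat) = j by have := ltn_ord r; lia.
  by rewrite subnn.
rewrite big_ord_recr /= mulrAC IH mulrDr mulr1 addSn; set n := (i + j)%N in IH *.
pose th r := theta_term u v j r.
rewrite [RHS]big_ord_recl gbinn0 mul1r.
rewrite [X in _ = _ + X](eq_bigr (fun r : 'I_n.+1 => gbin P n r.+1 * th r.+1 +
    P ^+ (n - r) * gbin P n r * th r.+1)); last first.
  move=> r _; rewrite lift0.
  by rewrite gbinS_alt ?mulrDl // -ltnS ltn_ord.
rewrite big_split /= addrA; congr (_ + _).
  rewrite [X in _ = _ + X]big_ord_recr /= gbin_small // mul0r addr0.
  by rewrite big_ord_recl gbinn0 mul1r.
rewrite mulr_suml; apply: eq_bigr => r _.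
suff key : th r * (u * P ^+ i) = P ^+ (n - r) * th r.+1.
  transitivity (gbin P n r * (th r * (u * P ^+ i))); first by rewrite mulrA.
  by rewrite key mulrCA mulrA.
have rn := ltn_ord r; rewrite /th /theta_term -/P.
case: (leqP j r) => jr.
  rewrite leqW // subSn // binS bin1 [P ^+ (_ + _)]exprD.
  have -> : P ^+ i = P ^+ (r - j) * P ^+ (n - r).
    by rewrite -exprD; congr (_ ^+ _); have : n = (i + j)%N by []; lia.
  by rewrite [u ^+ _.+1]exprS; ring.
have -> : (if (j <= r.+1)%N then u ^+ (r.+1 - j) * P ^+ 'C(r.+1 - j, 2)
           else v ^+ (j - r.+1) * P ^+ 'C(j - r.+1, 2))
          = v ^+ (j - r.+1) * P ^+ 'C(j - r.+1, 2).
  case: leqP => // jr1; have -> : j = r.+1 by lia.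
  by rewrite subnn !expr0.
have -> : (j - r = (j - r.+1).+1)%N by lia.
have -> : P ^+ (n - r) = P ^+ i * P ^+ (j - r.+1) * (u * v).
  by rewrite -/P -exprD -exprSr; congr (_ ^+ _); have : n = (i + j)%N by []; lia.
rewrite binS bin1 [P ^+ (_ + _)]exprD [v ^+ _.+1]exprS.
by move: (P ^+ i) (P ^+ _) (P ^+ _) (v ^+ _) => *; ring.
Qed.

(** Jacobi's triple product in the variables [u], [v] with base [u * v], so that
neither variable needs to be invertible.  In [2K] factors of each kind, the
coefficients of the terms at distance at most [K] from the centre have reached
their limit and the other terms vanish. *)
Lemma triple_product u v K : (u * v) ^+ K = 0 ->
  qpoch (u * v) (u * v) K *
    ((\prod_(l < K) (1 + u * (u * v) ^+ l)) * (\prod_(l < K) (1 + v * (u * v) ^+ l)))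
  = \sum_(d < K.*2.+1) u ^+ d * (u * v) ^+ 'C(d, 2)
    + \sum_(d < K.*2) v ^+ d.+1 * (u * v) ^+ 'C(d.+1, 2).
Proof.
set P := u * v => P0.
have stab w : \prod_(l < K) (1 + w * P ^+ l) = \prod_(l < K.*2) (1 + w * P ^+ l).
  rewrite -addnn big_split_ord [X in _ = _ * X]big1 ?mulr1 // => l _.
  by rewrite (expr_nil P0) ?mulr0 ?addr0 // leq_addr.
rewrite !stab finite_triple_product -/P.
have -> : \sum_(d < K.*2.+1) u ^+ d * P ^+ 'C(d, 2)
    + \sum_(d < K.*2) v ^+ d.+1 * P ^+ 'C(d.+1, 2)
    = \sum_(r < (K.*2 + K.*2).+1) theta_term u v K.*2 r.
  rewrite -addnS big_split_ord /= [LHS]addrC; congr (_ + _).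
    rewrite (reindex_inj rev_ord_inj) /=; apply: eq_bigr => r _.
    have rK := ltn_ord r; rewrite /theta_term /=; case: leqP => [|_]; first by lia.
    by congr (v ^+ _ * P ^+ 'C(_, _)); lia.
  by apply: eq_bigr => r _; rewrite /theta_term leq_addr addKn.
rewrite mulr_sumr; apply: eq_bigr => r _; rewrite mulrA.
have [rs|rb] := boolP ((K <= r) && (r <= K.*2 + K))%N.
  suff -> : qpoch P P K * gbin P (K.*2 + K.*2) r = 1 by rewrite mul1r.
  case/andP: rs => r1 r2; rewrite -(@qpoch_stable P P K r) // mulrC.
  by apply: (gbin_lim P0); lia.
rewrite (_ : theta_term _ _ _ _ = 0) ?mulr0 // /theta_term -/P.
have big d : (K < d)%N -> P ^+ 'C(d, 2) = 0.
  move=> Kd; apply: (expr_nil P0); case: d Kd => // d.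
  by rewrite ltnS binS bin1 => Kd; rewrite (leq_trans Kd) // leq_addl.
have rn := ltn_ord r.
by case: leqP => jr; rewrite big ?mulr0 //; lia.
Qed.

End QSeries.

Arguments gbin : simpl never.

(** * Partitions with distinct parts, weighted row by row *)

Section Rows.

Variable A : comUnitRingType.
Variables (al ga x y : A).
Implicit Types (s : bool) (l m n K N : nat) (p : seq nat).

(** The weight of a row of length [l] filled alternately with two letters; the
rows of the two parities [s] use different pairs of letters: [al] and [x / al]
for [s = false], [ga] and [y / ga] for [s = true]. *)
Definition row_weight s l : A :=
  if s then y ^+ l./2 * ga ^+ odd l else x ^+ l./2 * al ^+ odd l.

Fixpoint rows_weight s p : A :=
  if p is l :: p' then row_weight s l * rows_weight (~~ s) p' else 1.

(** The total weight [rows_weight s] of the partitions with distinct parts, all at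
most [n], sorted by whether [n] is a part; if it is, the other rows change
parity. *)
Fixpoint distinct_rows s n : A :=
  if n is n'.+1 then
    distinct_rows s n' + row_weight s n * distinct_rows (~~ s) n'
  else 1.

End Rows.

Section DistinctRows.

Variable A : comUnitRingType.
Implicit Types (al ga x y P : A) (K N : nat).

Lemma gbin_sym P K n k : P ^+ K = 0 -> (k <= n)%N ->
  gbin P n (n - k) = gbin P n k.
Proof.
move=> P0 kn; have u j : qpoch P P j \is a GRing.unit by apply: qpoch_unit P0.
apply: (mulIr (u k)); apply: (mulIr (u (n - k)%N)); rewrite gbin_fact //.
by have := gbin_fact P (leq_subr k n); rewrite subKn // mulrAC.
Qed.

(** Andrews' closed form for the partitions with distinct parts at most [2N]. *)
Definition distinct_sum P al ga x N : A :=
  \sum_(j < N.+1) gbin P N j * qpoch (- al) P j * qpoch (- ga) P (N - j)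
                  * x ^+ (N - j).

(** This makes the sums for both parities of the first row combinations of the same
terms. *)
Lemma distinct_sum_swap P K al ga x y N : P ^+ K = 0 -> x * y = P ->
  x ^+ N * distinct_sum P ga al y N =
  \sum_(j < N.+1) gbin P N j * qpoch (- al) P j * qpoch (- ga) P (N - j)
                  * x ^+ (N - j) * P ^+ j.
Proof.
move=> P0 xy; rewrite /distinct_sum (reindex_inj rev_ord_inj) /= mulr_sumr.
apply: eq_bigr => j _; have jN : (j <= N)%N by rewrite -ltnS.
rewrite subSS subKn // (gbin_sym P0) // -xy exprMn.
by rewrite -{1}(subnK jN) exprD; ring.
Qed.

(** The recurrence of [distinct_rows] over two steps, read off from q-Pascal. *)
Lemma distinct_sumS P K al ga x y N : P ^+ K = 0 -> x * y = P ->
  distinct_sum P al ga x N.+1 =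
    (1 + x * ga * P ^+ N) * distinct_sum P al ga x N
    + (al + x) * (x ^+ N * distinct_sum P ga al y N).
Proof.
move=> P0 xy; rewrite (distinct_sum_swap _ _ _ P0 xy).
pose U i j := qpoch (- al) P i * qpoch (- ga) P j * x ^+ j.
rewrite [LHS]/distinct_sum big_ord_recl gbinn0 qpoch0 subn0 !mul1r.
rewrite (eq_bigr (fun j : 'I_N.+1 => gbin P N j * U j.+1 (N - j)%N +
  P ^+ j.+1 * gbin P N j.+1 * U j.+1 (N - j)%N)); last first.
  by move=> j _; rewrite lift0 gbinS subSS /U; ring.
rewrite big_split /= addrCA.
have -> : qpoch (- ga) P N.+1 * x ^+ N.+1 +
    \sum_(i < N.+1) P ^+ i.+1 * gbin P N i.+1 * U i.+1 (N - i)%N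
  = \sum_(j < N.+1) P ^+ j * gbin P N j * U j (N.+1 - j)%N.
  rewrite big_ord_recr /= gbin_small // mulr0 mul0r addr0 [in RHS]big_ord_recl /=.
  rewrite /U qpoch0 gbinn0 expr0 subn0 !mul1r; congr (_ + _).
rewrite /distinct_sum !mulr_sumr -!big_split /=; apply: eq_bigr => j _.
have jN : (j <= N)%N by rewrite -ltnS.
rewrite /U subSn // !qpochS exprS.
have -> : P ^+ N = P ^+ j * P ^+ (N - j) by rewrite -exprD subnKC.
by ring.
Qed.

Lemma distinct_rowsE al ga x y K N : (x * y) ^+ K = 0 ->
  distinct_rows al ga x y false N.*2 = distinct_sum (x * y) al ga x N /\
  distinct_rows al ga x y true N.*2 = distinct_sum (x * y) ga al y N.
Proof.
move=> P0; elim: N => [|N [IH0 IH1]].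
  by rewrite /distinct_sum !big_ord_recl !big_ord0 /= gbinn0 !qpoch0 !mul1r !addr0.
rewrite doubleS /= !negbK {}IH0 {}IH1 odd_double uphalf_double !doubleK /=.
rewrite !mulr1 !expr1.
rewrite (distinct_sumS _ _ _ P0 erefl) (mulrC x y).
rewrite (@distinct_sumS (y * x) K ga al y x N) 1?mulrC //.
move: (distinct_sum _ _ _ _ _) (distinct_sum _ _ _ _ _) => d1 d2.
by rewrite exprMn !exprS; split; ring.
Qed.

(** When the bound on the parts grows, the Gaussian binomials become reciprocal
q-factorials and the q-binomial theorem sums the series. *)
Lemma distinct_rows_lim al ga x y K N : (x * y) ^+ K = 0 -> x ^+ K = 0 ->
  (K.*2 <= N)%N ->
  distinct_rows al ga x y false N.*2 =
  qpoch (- al) (x * y) K * qpoch (- (ga * x)) (x * y) K / qpoch x (x * y) K.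
Proof.
move=> P0 x0 KN; have [-> _] := distinct_rowsE al ga N P0.
set P := x * y in P0 *; have xu : qpoch x P K \is a GRing.unit by apply: qpoch_unit x0.
have Pu j : qpoch P P j \is a GRing.unit by apply: qpoch_unit P0.
apply: (mulIr xu); rewrite mulrVK // -mulNr -(qbinomial _ P0 x0) mulrC.
rewrite [RHS]mulrCA; congr (_ * _).
rewrite /distinct_sum (reindex_inj rev_ord_inj) /= mulr_sumr.
have NK : (N.+1 = K + (N.+1 - K))%N by lia.
rewrite NK big_split_ord /= -NK [X in _ + X]big1 ?addr0 => [|j _]; last first.
  by rewrite subSS subKn ?(expr_nil x0) ?mulr0 ?leq_addr //; have := ltn_ord j; lia.
apply: eq_bigr => j _; have jK := ltn_ord j.
rewrite subSS subKn; last by lia.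
rewrite (gbin_sym P0); last by lia.
rewrite (@qpoch_stable _ _ P K (N - j)) //; last by lia.
have e : gbin P N j = (qpoch P P j)^-1.
  by apply: (mulIr (Pu j)); rewrite mulVr // (gbin_lim P0) //; lia.
by rewrite e; ring.
Qed.

End DistinctRows.

(** * Lists of partitions and the crank *)

Section PartitionLists.

Implicit Types (a n K : nat) (p : seq nat).

(** The partitions with parts in the interval from [a + 1] to [a + n], each part
having multiplicity less than [K], built from the largest part downwards. *)
Fixpoint partitions a n K : seq (seq nat) :=
  if n is n'.+1 then
    [seq nseq f (a + n)%N ++ p | f <- iota 0 K, p <- partitions a n' K]
  else [:: [::]].

Lemma big_partitions0 (A : nmodType) (F : seq nat -> A) a K :
  \sum_(p <- partitions a 0 K) F p = F [::].
Proof. by rewrite big_seq1. Qed.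

Lemma big_partitionsS (A : nmodType) (F : seq nat -> A) a n K :
  \sum_(p <- partitions a n.+1 K) F p =
  \sum_(f < K) \sum_(p <- partitions a n K) F (nseq f (a + n.+1)%N ++ p).
Proof.
by rewrite big_allpairs_dep -(big_mkord xpredT
  (fun f => \sum_(p <- partitions a n K) F (nseq f (a + n.+1)%N ++ p))) /index_iota subn0.
Qed.

Lemma partitions_bound a n K p : p \in partitions a n K -> all (fun x => a < x <= a + n)%N p.
Proof.
elim: n p => [|n IH] p /=; first by rewrite inE => /eqP ->.
case/allpairsP => [[f p'] /= [_ /IH p'P ->]]; rewrite all_cat all_nseq; apply/andP.
split; first by rewrite leqnn andbT; case: f => //= _; lia.
by apply: sub_all p'P => x; lia.
Qed.

(** The shape of the crank depends on the number of ones, so these are split off. *)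
Lemma big_partitions_ones (A : nmodType) (F : seq nat -> A) n K :
  \sum_(p <- partitions 0 n.+1 K) F p =
  \sum_(m < K) \sum_(p <- partitions 1 n K) F (p ++ nseq m 1%N).
Proof.
elim: n F => [|n IH] F.
  rewrite big_partitionsS; apply: eq_bigr => m _.
  by rewrite !big_partitions0 cats0.
rewrite big_partitionsS; under eq_bigr => f _ do rewrite IH.
rewrite exchange_big; apply: eq_bigr => m _.
rewrite big_partitionsS; apply: eq_bigr => f _; apply: eq_bigr => p _.
by rewrite catA.
Qed.

Lemma sumn_nseq_cat f x p : sumn (nseq f x ++ p) = (x * f + sumn p)%N.
Proof. by rewrite sumn_cat sumn_nseq. Qed.

Lemma big_partitions_mult (A : comUnitRingType) (w : nat -> A) a n K :
  (forall i, (i < n)%N -> w (a + i.+1)%N ^+ K = 0) ->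
  \sum_(p <- partitions a n K) \prod_(x <- p) w x =
  \prod_(i < n) (1 - w (a + i.+1)%N)^-1.
Proof.
elim: n => [|n IH] wK; first by rewrite big_partitions0 big_nil big_ord0.
rewrite big_partitionsS big_ord_recr /= -IH => [|i ni]; last by rewrite wK // ltnW.
rewrite (inv_sub_nil (wK n _)) // mulrC mulr_suml; apply: eq_bigr => f _.
rewrite mulr_sumr; apply: eq_bigr => p _.
by rewrite big_cat big_nseq iter_mulr_1.
Qed.

End PartitionLists.

Section CrankGF.

Variable A : comUnitRingType.
Variables (z q : A) (K : nat).
Hypothesis zu : z \is a GRing.unit.
Hypothesis K_gt0 : (0 < K)%N.
Hypothesis qK : q ^+ K = 0.

(** [z ^ crank p], with natural exponents of [z] and [z^-1] as they arise from the
product over the parts. *)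
Definition crank_weight (p : seq nat) : A :=
  if mult p 1 == 0%N then z ^+ largest p
  else z ^+ count (fun x => mult p 1 < x)%N p * z^-1 ^+ mult p 1.

Lemma qpow_nil (c : A) n : (0 < n)%N -> (c * q ^+ n) ^+ K = 0.
Proof. by move=> n0; rewrite mul_nil // exp_nil. Qed.

Let qu n : qpoch q q n \is a GRing.unit. Proof. exact: qpoch_unit qK. Qed.
Let zqu n : qpoch (z * q) q n \is a GRing.unit.
Proof. by apply: (@qpoch_unit _ _ _ K); apply: mul_nil. Qed.
Let oneq : 1 - q \is a GRing.unit. Proof. exact: unit_sub_nil qK. Qed.

Lemma prod_pow (p : seq nat) : \prod_(x <- p) q ^+ x = q ^+ sumn p.
Proof. by elim: p => [|x p IH]; rewrite ?big_nil // big_cons IH -exprD. Qed.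

Lemma gf_no_ones n :
  \sum_(p <- partitions 1 n K) q ^+ sumn p = (1 - q) / qpoch q q n.+1.
Proof.
under eq_bigr => p _ do rewrite -prod_pow.
rewrite (@big_partitions_mult A (fun x => q ^+ x)) => [|i _]; last exact: exp_nil.
apply: (mulIr (qu n.+1)); rewrite mulrVK // qpochSl mulrCA -[RHS]mulr1.
congr (_ * _); rewrite /qpoch -big_split /= big1 // => i _.
have -> : q * q * q ^+ i = q ^+ (1 + i.+1) by rewrite add1n !exprS mulrA.
by rewrite mulVr // (@unit_sub_nil _ _ K) // exp_nil.
Qed.

(** The partitions with largest part [j > 1] contribute [1 - q] times the [j]-th
summand on the right.  In place of the 1 of the empty partition, the right-hand
sum has the terms [j = 0] and [j = 1], which make [1 - q + z * q]. *)
Lemma gf_no_ones_largest n :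
  \sum_(p <- partitions 1 n K) z ^+ largest p * q ^+ sumn p =
  q - z * q + (1 - q) * \sum_(j < n.+2) (z * q) ^+ j / qpoch q q j.
Proof.
elim: n => [|n IH].
  rewrite big_partitions0 !expr0 !big_ord_recl big_ord0 /= qpoch0 invr1 !mul1r addr0.
  rewrite qpochS qpoch0 expr0 mulr1 mul1r mulrDr mulr1 expr1.
  by rewrite [X in _ + (_ + X)]mulrC divrK //; ring.
rewrite big_partitionsS [in RHS]big_ord_recr /= mulrDr addrA -IH.
pose x := q ^+ n.+2; pose S := \sum_(p <- partitions 1 n K) q ^+ sumn p.
have xK : x ^+ K = 0 by exact: exp_nil.
have x1 : 1 - x \is a GRing.unit by exact: unit_sub_nil xK.
pose i0 := Ordinal K_gt0; rewrite (bigD1 i0) //=; congr (_ + _).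
transitivity (z ^+ n.+2 * S * \sum_(f < K | f != i0) x ^+ f).
  rewrite mulr_sumr; apply: eq_bigr => f f0.
  rewrite mulrAC mulr_sumr; apply: eq_bigr => p _.
  rewrite sumn_nseq_cat exprD exprM.
  have -> : largest (nseq f n.+2 ++ p) = n.+2.
    by case: f f0 => [[|f] ?] //=; rewrite -val_eqE.
  by rewrite !mulrA.
have -> : \sum_(f < K | f != i0) x ^+ f = x / (1 - x).
  have := inv_sub_nil xK; rewrite (bigD1 i0) //= expr0 => geo.
  apply: (addrI 1); rewrite -geo; apply: (mulIr x1).
  by rewrite mulrDl mulVr // mulrVK // mul1r subrK.
rewrite /S gf_no_ones [qpoch _ _ n.+2]qpochS -exprS -/x invrM //.
by rewrite exprMn -/x; ring.
Qed.

(** The parts above [m.+1] carry a factor [z] and the smaller ones do not; the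
product over the parts at least 2 is then a quotient of two q-factorials. *)
Lemma crank_factors m d (w := fun x => (if (m.+1 < x)%N then z else 1) * q ^+ x) :
  \prod_(i < m + d) (1 - w (1 + i.+1)%N) * (qpoch (z * q) q m.+1 * (1 - q))
  = qpoch q q m.+1 * qpoch (z * q) q (m + d).+1.
Proof.
elim: d => [|d IH].
  rewrite addn0 [in RHS]mulrC mulrCA; congr (_ * _); rewrite qpochSl mulrC.
  congr (_ * _); apply: eq_bigr => i _; rewrite /w ltnNge add1n ltnS ltn_ord /=.
  by rewrite mul1r !exprS mulrA.
rewrite addnS big_ord_recr /= mulrAC IH [qpoch _ _ (m + d).+2]qpochS mulrA; congr (_ * (1 - _)).
rewrite /w ltnS add1n ltnS leq_addr exprS mulrA exprS; ring.
Qed.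

Lemma crank_gf_ones m n : (0 < m)%N -> (m <= n.+1)%N ->
  \sum_(p <- partitions 1 n K) crank_weight (p ++ nseq m 1%N) * q ^+ sumn (p ++ nseq m 1%N)
  = (1 - q) / qpoch (z * q) q n.+1 *
    (qpoch (z * q) q m / qpoch q q m * (z^-1 * q) ^+ m).
Proof.
case: m => // m _; rewrite ltnS => /subnKC <-; move: (n - m)%N => d.
pose w x := (if (m.+1 < x)%N then z else 1) * q ^+ x.
rewrite (eq_big_seq (fun p => (z^-1 * q) ^+ m.+1 * \prod_(x <- p) w x)) => [|p]; last first.
  move=> /partitions_bound pP.
  have p1 : count_mem 1%N p = 0%N.
    apply/eqP; rewrite -leqn0 leqNgt -has_count; apply/hasPn => x /(allP pP) /= x2.
    by apply/eqP => x1; rewrite x1 in x2.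
  have mult1 : mult (p ++ nseq m.+1 1%N) 1 = m.+1.
    by rewrite /mult count_cat p1 count_nseq /= mul1n.
  rewrite /crank_weight mult1 (_ : (m.+1 == 0)%N = false) // count_cat count_nseq.
  rewrite [X in (X * m.+1)%N]/= mul0n addn0.
  rewrite sumn_cat (sumn_nseq 1) mul1n.
  have -> : \prod_(x <- p) w x = z ^+ count (fun x => m.+1 < x)%N p * q ^+ sumn p.
    elim: p {pP p1 mult1} => [|x p IH]; first by rewrite big_nil mulr1.
    rewrite big_cons IH /w /= !exprD; case: leqP => _; rewrite ?mul1r; ring.
  by rewrite exprMn exprD; ring.
rewrite -mulr_sumr big_partitions_mult => [|i _]; last by rewrite /w qpow_nil.
have wu : \prod_(i < m + d) (1 - w (1 + i.+1)%N) \is a GRing.unit.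
  by rewrite unitr_prod // => i _; apply: (@unit_sub_nil _ _ K); rewrite /w qpow_nil.
apply: (mulrI wu); rewrite mulrCA.
have -> : \prod_(i < m + d) (1 - w (1 + i.+1)%N) * \prod_(i < m + d) (1 - w (1 + i.+1)%N)^-1 = 1.
  rewrite -big_split big1 //= => i _; rewrite mulrV //.
  by apply: (@unit_sub_nil _ _ K); rewrite /w qpow_nil.
rewrite mulr1 !mulrA; apply: (mulIr (qu m.+1)); apply: (mulIr (zqu (m + d).+1)).
rewrite -mulrA [X in X = _]mulrC.
transitivity (qpoch q q m.+1 * qpoch (z * q) q (m + d).+1
   * (z^-1 * q) ^+ m.+1 * (qpoch q q m.+1 * (qpoch q q m.+1)^-1)
   * (qpoch (z * q) q (m + d).+1 * (qpoch (z * q) q (m + d).+1)^-1)).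
  by rewrite !mulrV // !mulr1.
by rewrite -crank_factors -/w; ring.
Qed.

(** The Andrews-Garvan theorem.  The partitions with [m > 0] ones give the [m]-th
term of the q-binomial series with [a = z q] and [x = q / z], those without
ones give its initial term, by the same theorem with [a = 0], and the stray
[q (1 - z)]. *)
Lemma crank_gf n : (K <= n.+1)%N ->
  \sum_(p <- partitions 0 n.+1 K) crank_weight p * q ^+ sumn p =
  q * (1 - z) + qpoch q q K / (qpoch (z * q) q K * qpoch (z^-1 * q) q K).
Proof.
move=> Kn; rewrite big_partitions_ones; pose i0 := Ordinal K_gt0.
have zqK := mul_nil z qK; have ziqK := mul_nil z^-1 qK.
have ziqu j : qpoch (z^-1 * q) q j \is a GRing.unit by exact: qpoch_unit ziqK.
have zq_stable : qpoch (z * q) q n.+1 = qpoch (z * q) q K by exact: qpoch_stable.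
pose c i := qpoch (z * q) q i / qpoch q q i * (z^-1 * q) ^+ i.
rewrite (bigD1 i0) //= [X in _ + X](eq_bigr (fun m : 'I_K =>
    (1 - q) / qpoch (z * q) q K * c m)); last first.
  move=> m m0; rewrite crank_gf_ones ?zq_stable //.
    by rewrite lt0n.
  by rewrite (leq_trans (ltnW (ltn_ord m))).
rewrite -mulr_sumr.
have -> : \sum_(m < K | m != i0) c m = qpoch (q * q) q K / qpoch (z^-1 * q) q K - 1.
  set S := \sum_(m < K | m != i0) c m.
  have e : qpoch (z^-1 * q) q K * (1 + S) = qpoch (z * q * (z^-1 * q)) q K.
    rewrite -(qbinomial (z * q) qK ziqK) (bigD1 i0) //= -/(c 0%N); congr (_ * (_ + _)).
    by rewrite /c !qpoch0 invr1 !mulr1.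
  have -> : q * q = z * q * (z^-1 * q) by rewrite mulrACA mulrV // mul1r.
  by rewrite -e [X in X - _]mulrC mulKr // addrAC subrr add0r.
have -> : \sum_(p <- partitions 1 n K) crank_weight (p ++ nseq 0 1%N) * q ^+ sumn (p ++ nseq 0 1%N)
   = q - z * q + (1 - q) / qpoch (z * q) q K.
  rewrite (eq_big_seq (fun p => z ^+ largest p * q ^+ sumn p)) => [|p]; last first.
    move=> /partitions_bound pP; rewrite cats0 /crank_weight.
    have -> : mult p 1 = 0%N; last by rewrite eqxx.
    apply/eqP; rewrite -leqn0 leqNgt -has_count; apply/hasPn => x /(allP pP) /= x2.
    by apply/eqP => x1; rewrite x1 in x2.
  rewrite gf_no_ones_largest; congr (_ + _ * _).
  have := qbinomial 0 qK zqK; rewrite mul0r.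
  have q00 j : qpoch 0 q j = 1.
    by rewrite /qpoch big1 // => i _; rewrite mul0r subr0.
  rewrite q00 => e; apply: (mulrI (zqu K)); rewrite mulrV // -e; congr (_ * _).
  have nK : (n.+2 = K + (n.+2 - K))%N by lia.
  rewrite nK big_split_ord /= [X in _ + X]big1 ?addr0 => [|i _].
    by apply: eq_bigr => i _; rewrite q00 mul1r mulrC.
  by rewrite (expr_nil zqK) ?mul0r // leq_addr.
have -> : qpoch q q K = (1 - q) * qpoch (q * q) q K.
  by rewrite -qpochSl (qpoch_stable _ qK).
by rewrite invrM //; ring.
Qed.

End CrankGF.

(** * Removing pairs of equal parts *)

Section BijectionOne.

Implicit Types (p : seq nat) (f : nat -> nat) (m n K : nat) (s : bool).

Lemma geq_trans : transitive geq.
Proof. by move=> y x z; rewrite /= => yx zy; exact: leq_trans zy yx. Qed.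

Lemma partition_cons x p :
  is_partition (x :: p) = [&& (0 < x)%N, largest p <= x & is_partition p]%N.
Proof.
rewrite /is_partition inE negb_or eq_sym -lt0n.
case: (0 < x)%N; last by rewrite andbF.
by case: p => [|y p] //=; rewrite -andbA.
Qed.

Lemma largest_max p : is_partition p -> all (fun x => x <= largest p)%N p.
Proof.
case: p => //= x p /andP[]; rewrite leqnn /= (path_sortedE geq_trans).
by case/andP.
Qed.

Lemma mult_largest p x : is_partition p -> (largest p < x)%N -> mult p x = 0%N.
Proof.
move=> /largest_max pP lx; apply/eqP; rewrite -leqn0 leqNgt -has_count.
apply/hasPn => y /(allP pP) yl; apply: contraTN lx => /eqP <-.
by rewrite -leqNgt.
Qed.

Lemma partitions_largest a n K p : p \in partitions a n K -> (largest p <= a + n)%N.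
Proof. by move/partitions_bound; case: p => //= x p /andP[/andP[]]. Qed.

Lemma largest_nseq_cat (f x : nat) p : (largest p <= x)%N -> (largest (nseq f x ++ p) <= x)%N.
Proof. by case: f => /=. Qed.

Lemma partition_nseq_cat (f x : nat) p : (0 < x)%N -> (largest p <= x)%N ->
  is_partition p -> is_partition (nseq f x ++ p).
Proof.
move=> x0 px pP; elim: f => //= f IH.
by rewrite partition_cons x0 largest_nseq_cat.
Qed.

Lemma partitions_partition a n K p : p \in partitions a n K -> is_partition p.
Proof.
elim: n p => [|n IH] p /=; first by rewrite inE => /eqP ->.
case/allpairsP => [[f p'] /= [_ p'P ->]].
by rewrite addnS partition_nseq_cat ?(leqW (partitions_largest p'P)) // IH.
Qed.

Lemma of_multsS m f : of_mults m.+1 f = nseq (f m.+1) m.+1 ++ of_mults m f.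
Proof.
have e : iota 1 m.+1 = rcons (iota 1 m) m.+1 by rewrite -cats1 -(iotaD 1 m 1) addn1.
by rewrite /of_mults e rev_rcons.
Qed.

Lemma eq_of_mults m f g : (forall j, (0 < j <= m)%N -> f j = g j) ->
  of_mults m f = of_mults m g.
Proof.
elim: m => // m IH fg; rewrite !of_multsS fg ?leqnn // IH // => j /andP[j0 jm].
by rewrite fg // j0 leqW.
Qed.

Lemma of_mults_stable m n f : (forall j, (m < j)%N -> f j = 0%N) -> (m <= n)%N ->
  of_mults n f = of_mults m f.
Proof.
move=> f0 /subnKC <-; elim: (n - m)%N => [|d IH]; first by rewrite addn0.
by rewrite addnS of_multsS f0 ?IH // ltnS leq_addr.
Qed.

Definition pi_one p : seq nat := (bijection1 p).1.

(** Frees the first component from the bound that comes from the largest part. *)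
Lemma pi_oneE m p : is_partition p -> (largest p <= m.*2)%N ->
  pi_one p = of_mults m (fun j => mult p j.*2 %/ 2)%N.
Proof.
move=> pP pm; set f := (X in of_mults _ X).
pose b := minn m (largest p).
have fb j : (b < j)%N -> f j = 0%N.
  rewrite /b gtn_min => bj; rewrite /f mult_largest // ; lia.
rewrite /pi_one /= -/f (@of_mults_stable b _ f) ?geq_minr //.
by rewrite (@of_mults_stable b m f) ?geq_minl.
Qed.

Lemma pi_one_cat m K p (f2 f1 : nat) : p \in partitions 0 m.*2 K ->
  pi_one (nseq f2 m.+1.*2 ++ nseq f1 m.*2.+1 ++ p) = nseq (f2 %/ 2) m.+1 ++ pi_one p.
Proof.
move=> pP; have pl := partitions_largest pP; have pp := partitions_partition pP.
have nP : is_partition (nseq f1 m.*2.+1 ++ p) by rewrite partition_nseq_cat // leqW.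
have nl : (largest (nseq f1 m.*2.+1 ++ p) <= m.*2.+1)%N.
  by rewrite largest_nseq_cat // leqW.
rewrite (@pi_oneE m.+1) ?(@pi_oneE m p) //; last first.
- by rewrite largest_nseq_cat // doubleS leqW.
- by rewrite partition_nseq_cat // doubleS leqW.
have mE j : mult (nseq f2 m.+1.*2 ++ nseq f1 m.*2.+1 ++ p) j.*2 =
    (if j == m.+1 then f2 + mult p j.*2 else mult p j.*2)%N.
  rewrite /mult !count_cat !count_nseq /=.
  have -> : (m.*2.+1 == j.*2)%N = false by lia.
  have -> : (m.+1.*2 == j.*2)%N = (j == m.+1) by lia.
  by case: eqP; rewrite ?mul1n ?mul0n.
rewrite of_multsS mE eqxx mult_largest ?addn0 //; last by rewrite doubleS ltnS leqW.
congr (_ ++ _); apply: eq_of_mults => j /andP[_ jm].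
by rewrite mE ltn_eqF.
Qed.

Variable A : comUnitRingType.
Variables (al ga x y : A) (K : nat).
Local Notation P := (x * y).
Hypothesis PK : P ^+ K = 0.
Local Notation W := (rows_weight al ga x y).
Local Notation row_weight := (row_weight al ga x y).
Local Notation dist := (distinct_rows al ga x y).

(** Two equal consecutive rows weigh the same at either parity, and leave the parity
of the following rows alone.  This is why pairs can be taken out. *)
Lemma row_weight_pair s l :
  row_weight s l * row_weight (~~ s) l = P ^+ l./2 * (al * ga) ^+ odd l.
Proof. by case: s; rewrite /row_weight /= !exprMn; ring. Qed.

Lemma rows_nseq s l (f : nat) p :
  W s (nseq f.*2 l ++ p) = (P ^+ l./2 * (al * ga) ^+ odd l) ^+ f * W s p.
Proof.
elim: f => [|f IH]; first by rewrite mul1r.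
by rewrite doubleS /= negbK IH mulrA row_weight_pair exprS mulrA.
Qed.

Lemma rows_nseqS s l (f : nat) p :
  W s (nseq f.*2.+1 l ++ p) =
  (P ^+ l./2 * (al * ga) ^+ odd l) ^+ f * (row_weight s l * W (~~ s) p).
Proof. by rewrite /= rows_nseq mulrCA. Qed.

Lemma sum_double (G : nat -> A) k :
  \sum_(f < k.*2) G f = \sum_(g < k) (G g.*2 + G g.*2.+1).
Proof.
elim: k => [|k IH]; first by rewrite !big_ord0.
by rewrite doubleS !big_ord_recr /= IH addrA.
Qed.

Lemma big_partitionsS_double (F : seq nat -> A) a n k :
  \sum_(p <- partitions a n.+1 k.*2) F p =
  \sum_(g < k) (\sum_(p <- partitions a n k.*2) F (nseq g.*2 (a + n.+1)%N ++ p)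
    + \sum_(p <- partitions a n k.*2) F (nseq g.*2.+1 (a + n.+1)%N ++ p)).
Proof.
rewrite big_partitionsS (sum_double
  (fun f : nat => \sum_(p <- partitions a n k.*2) F (nseq f (a + n.+1)%N ++ p))) //.
Qed.

(** Each multiplicity splits into a number of pairs and a remainder 0 or 1.  The
pairs of even parts make up the first component of Bijection 1, the pairs of odd
parts give a geometric series each, and the remainders a partition with distinct
parts. *)
Lemma big_pi_one_rows (Om : seq nat -> A) s m : (al * ga) ^+ K = 0 ->
  \sum_(p <- partitions 0 m.*2 K.*2) Om (pi_one p) * W s p =
  (\sum_(p <- partitions 0 m K) Om p * P ^+ sumn p) * dist s m.*2
   * \prod_(j < m) (1 - P ^+ j * (al * ga))^-1.
Proof.
move=> agK; elim: m s Om => [|m IH] s Om.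
  by rewrite !big_partitions0 big_ord0 /= !mulr1.
pose T s' Om' := \sum_(p <- partitions 0 m.*2 K.*2) Om' (pi_one p) * W s' p.
pose v := P ^+ m * (al * ga); pose u := P ^+ m.+1.
transitivity (\sum_(g < K) \sum_(h < K) u ^+ g * v ^+ h *
   (let Om' := fun p => Om (nseq g m.+1 ++ p) in
    T s Om' + row_weight s m.*2.+1 * T (~~ s) Om' +
    row_weight s m.+1.*2 * (T (~~ s) Om' + row_weight (~~ s) m.*2.+1 * T s Om'))).
  rewrite doubleS big_partitionsS_double; apply: eq_bigr => g _.
  rewrite !big_partitionsS_double -big_split /=; apply: eq_bigr => h _.
  rewrite /T /= !(mulr_sumr, =^~ big_split) /=.
  apply: eq_big_seq => p pP; rewrite !add0n -doubleS.
  have d0 k : (k.*2 %/ 2 = k)%N by rewrite divn2 doubleK.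
  have d1 k : (k.*2.+1 %/ 2 = k)%N by rewrite divn2 /= uphalf_double.
  have := pi_one_cat g.*2.+1 h.*2.+1 pP; have := pi_one_cat g.*2.+1 h.*2 pP.
  have := pi_one_cat g.*2 h.*2.+1 pP; have := pi_one_cat g.*2 h.*2 pP.
  rewrite !(d0, d1) /= => -> -> -> ->.
  have eu : P ^+ m.+1.*2./2 * (al * ga) ^+ odd m.+1.*2 = u.
    by rewrite doubleK odd_double expr0 mulr1.
  have ev : P ^+ m.*2.+1./2 * (al * ga) ^+ odd m.*2.+1 = v.
    by rewrite /= uphalf_double odd_double expr1.
  by rewrite !(rows_nseq, rows_nseqS) negbK eu ev; ring.
have PuK : v ^+ K = 0 by exact: mul_nil.
rewrite big_partitionsS big_ord_recr /= (inv_sub_nil PuK) -/v.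
pose C g := \sum_(p <- partitions 0 m K) Om (nseq g m.+1 ++ p) * P ^+ sumn p.
pose E := \prod_(j < m) (1 - P ^+ j * (al * ga))^-1.
transitivity (\sum_(g < K) \sum_(h < K) (u ^+ g * C g) * v ^+ h * (dist s m.+1.*2 * E)).
  apply: eq_bigr => g _; apply: eq_bigr => h _.
  by rewrite /T !(IH _ (fun p => Om (nseq g m.+1 ++ p))) -/(C g) -/E doubleS /= !negbK; ring.
rewrite -/E [RHS](_ : _ = (\sum_(g < K) u ^+ g * C g) * (\sum_(h < K) v ^+ h) * (dist s m.+1.*2 * E)).
  by rewrite big_distrlr mulr_suml; apply: eq_bigr => g _; rewrite mulr_suml.
rewrite -!mulrA; congr (_ * _); last by rewrite [in LHS]mulrA [LHS]mulrC doubleS.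
apply: eq_bigr => g _; rewrite /C mulr_sumr; apply: eq_bigr => p _.
by rewrite sumn_nseq_cat exprD exprM mulrCA.
Qed.

End BijectionOne.

(** * The srank as a sum over rows *)

Section SrankRows.

Implicit Types (p : seq nat) (s : bool) (l : nat).

(** Half the srank as a signed count of cells in rows; [s] tells the parity of
the first row. *)
Fixpoint half_srank s p : int :=
  if p is l :: p' then
    (if s then (uphalf l)%:Z else - (l./2)%:Z) + half_srank (~~ s) p'
  else 0.

(** The number of odd parts of the conjugate, with a free bound [B] on the columns
so that it can be compared for partitions with different largest parts. *)
Definition odd_columns p B := count odd [seq count (leq j) p | j <- iota 1 B].

Lemma odd_columns_stable p B : is_partition p -> (largest p <= B)%N ->
  odd_columns p B = num_odd_parts (conj_partition p).
Proof.
move=> pP pB; rewrite conj_partitionE // /num_odd_parts -/(odd_columns p _).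
rewrite -(subnKC pB) /odd_columns iotaD map_cat count_cat.
rewrite [X in (_ + X)%N](_ : _ = 0%N) ?addn0 //; apply/eqP.
rewrite -leqn0 leqNgt -has_count has_map; apply/hasPn => j; rewrite mem_iota => jP /=.
rewrite (_ : count _ _ = 0%N) //; apply/eqP; rewrite -leqn0 leqNgt -has_count.
by apply/hasPn => x /(allP (largest_max pP)); rewrite -ltnNge; lia.
Qed.

(** A new first row of length [l] flips the parity of each of the [l] columns. *)
Lemma odd_columns_cons l p : (odd_columns (l :: p) l + odd_columns p l = l)%N.
Proof.
rewrite /odd_columns !count_map.
rewrite -[RHS](size_iota 1) -(count_predC (preim (fun j => count (leq j) p) odd)) addnC.
congr addn; apply: eq_in_count => j; rewrite mem_iota => /andP[_ jl] /=.
by rewrite (_ : (j <= l)%N) ?oddD //; lia.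
Qed.

(** By [odd_columns_cons] a new first row exchanges, up to a term in its length, the
difference and the sum of the numbers of odd rows and odd columns, so both are
handled together. *)
Lemma srank_half_srank p : is_partition p ->
  srank p = half_srank false p * 2 /\
  ((num_odd_parts p)%:Z + (num_odd_parts (conj_partition p))%:Z = half_srank true p * 2)%R.
Proof.
elim: p => [|l p IH]; first by [].
move=> lpP; have := lpP; rewrite partition_cons => /and3P[l0 pl pP].
have [IH0 IH1] := IH pP; have := odd_columns_cons l p.
rewrite (odd_columns_stable pP pl) -(odd_columns_stable lpP (leqnn _)) /=.
move: IH0; rewrite /srank -(odd_columns_stable lpP (leqnn _)) /= => IH0 e.
rewrite /num_odd_parts /= -/(num_odd_parts p); lia.
Qed.

Lemma srank_double p : is_partition p -> srank p = half_srank false p * 2.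
Proof. by case/srank_half_srank. Qed.

End SrankRows.

Section Weights.

Variable A : comUnitRingType.
Implicit Types q z t : A.

(** With these letters, the cells in even columns of the rows of parity [false]
weigh [q / t], those in odd columns of the rows of parity [true] weigh [t * q],
and all the others [q]. *)
Lemma rows_srank q t s p : t \is a GRing.unit ->
  rows_weight q (t * q) (t^-1 * q ^+ 2) (t * q ^+ 2) s p = t ^ (half_srank s p) * q ^+ sumn p.
Proof.
move=> tu; elim: p s => [|l p IH] s; first by rewrite /= mulr1.
rewrite /= IH exprzDr // exprD.
have lE : q ^+ l = (q ^+ 2) ^+ l./2 * q ^+ odd l.
  by rewrite -exprM -exprD; congr (_ ^+ _); lia.
have -> : row_weight q (t * q) (t^-1 * q ^+ 2) (t * q ^+ 2) s l
   = t ^ (if s then (uphalf l)%:Z else - (l./2)%:Z) * q ^+ l.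
  rewrite lE /row_weight; case: s; rewrite !exprMn.
    by rewrite -exprnP uphalf_half addnC exprD; ring.
  by rewrite exprVn -exprnN; ring.
by ring.
Qed.

Lemma crank_weightE z p : z \is a GRing.unit -> crank_weight z p = z ^ (crank p).
Proof.
move=> zu; rewrite /crank_weight /crank; case: eqP => _; first by rewrite exprnP.
by rewrite exprzDr // -exprnP -exprnN exprVn.
Qed.

End Weights.

Section NoRepeatedEven.

Implicit Types (p : seq nat).

Lemma of_mults_nil m f : (of_mults m f == [::]) = all (fun j => f j == 0%N) (iota 1 m).
Proof.
elim: m => // m IH; rewrite of_multsS -[m.+1 in RHS]addn1 iotaD all_cat -IH /= add1n.
by case: (f m.+1) => [|k]; rewrite ?andbT ?andbF.
Qed.

Lemma pi_one_eq0 p : is_partition p -> (pi_one p == [::]) = no_repeated_even_parts p.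
Proof.
move=> pP; rewrite (@pi_oneE (largest p)) //; last by rewrite -addnn leq_addr.
rewrite of_mults_nil; apply/allP/allP => h x.
  move=> xp; rewrite -implyNb; apply/implyP => ex.
  have x0 : (0 < x)%N by case/andP: pP => _; apply: contraNltn; rewrite leqn0 => /eqP <-.
  have xl := allP (largest_max pP) _ xp.
  have : x./2 \in iota 1 (largest p) by rewrite mem_iota; lia.
  by move/h; rewrite even_halfK //; lia.
rewrite mem_iota => xP; apply: contraT; rewrite -lt0n divn_gt0 // => x2.
have xp : x.*2 \in p by rewrite -has_pred1 has_count (leq_trans _ x2).
by have := h _ xp; rewrite odd_double /= leqNgt x2.
Qed.

End NoRepeatedEven.

Section StcrankGF.

Variables (A : comUnitRingType) (q z t : A) (K : nat).
Hypotheses (zu : z \is a GRing.unit) (tu : t \is a GRing.unit).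
Hypotheses (K0 : (0 < K)%N) (qK : q ^+ K = 0).
Local Notation P := (q ^+ 4).

(** The Andrews-Stanley product; the factors [1 + q^(2j-1)] are split by the residue
of the exponent mod 4. *)
Definition gf_no_repeats : A :=
  qpoch (- q) P K * qpoch (- q ^+ 3) P K
  / (qpoch (t^-1 * q ^+ 2) P K * qpoch (t * q ^+ 2) P K).

(** Any weight [Om] of the first component factors out: [crank] gives the main
series, and the indicator of the empty partition the correction. *)
Lemma gf_rows (Om : seq nat -> A) :
  \sum_(p <- partitions 0 K.*2.*2 K.*2)
     Om (pi_one p) * (t ^ (half_srank false p) * q ^+ sumn p) =
  (\sum_(p <- partitions 0 K.*2 K) Om p * P ^+ sumn p) * gf_no_repeats.
Proof.
pose x := t^-1 * q ^+ 2; pose y := t * q ^+ 2.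
have xy : x * y = P by rewrite mulrACA mulVr // mul1r -exprD.
have q2K : (q ^+ 2) ^+ K = 0 by exact: exp_nil.
have PK : P ^+ K = 0 by exact: exp_nil.
under eq_bigr => p _ do rewrite -rows_srank // -/x -/y.
rewrite big_pi_one_rows ?xy //; last first.
  by rewrite mulrCA -expr2; exact: mul_nil.
rewrite (@distinct_rows_lim _ _ _ x y K) ?xy //; last exact: mul_nil.
rewrite -mulrA; congr (_ * _); rewrite /gf_no_repeats -/x -/y.
have -> : t * q * x = q ^+ 3.
  by rewrite /x mulrACA mulrV // mul1r -exprS.
have yu : qpoch y P K \is a GRing.unit by apply: (@qpoch_unit _ _ _ K); exact: mul_nil.
have xu : qpoch x P K \is a GRing.unit by apply: (@qpoch_unit _ _ _ K); exact: mul_nil.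
rewrite invrM // [RHS]mulrA [LHS]mulrAC; congr (_ * _ / _).
rewrite -(@qpoch_stable _ y P K K.*2) //; last by rewrite -addnn leq_addr.
rewrite /qpoch -prodrV => [|j _]; last first.
  by apply: (@unit_sub_nil _ _ K); rewrite mulrAC; do 2!apply: mul_nil.
apply: eq_bigr => j _.
by rewrite mulrC /y; congr (1 - _)^-1; rewrite mulrC -mulrA; ring.
Qed.

Lemma gf_empty m : \sum_(p <- partitions 0 m K) (p == [::])%:R * P ^+ sumn p = 1.
Proof.
elim: m => [|m IH]; first by rewrite big_partitions0 eqxx mulr1.
rewrite big_partitionsS (bigD1 (Ordinal K0)) //= IH big1 ?addr0 // => f f0.
rewrite big1 // => p _; case: f f0 => [[|f] fK]; rewrite -?val_eqE //= => _.
by rewrite mul0r.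
Qed.

(** The correction [(z - 1) q^4], supported on the partitions without repeated even
parts, cancels the defect of the crank generating function. *)
Lemma gf_stcrank :
  \sum_(p <- partitions 0 K.*2.*2 K.*2)
    (z ^ (crank (pi_one p)) + (z - 1) * P * (pi_one p == [::])%:R) *
    (t ^ (half_srank false p) * q ^+ sumn p) =
  qpoch P P K / (qpoch (z * P) P K * qpoch (z^-1 * P) P K) * gf_no_repeats.
Proof.
have PK : P ^+ K = 0 by exact: exp_nil.
rewrite (gf_rows (fun s => z ^ (crank s) + (z - 1) * P * (s == [::])%:R)); congr (_ * _).
under eq_bigr => p _ do rewrite mulrDl -(crank_weightE _ zu) -(mulrA _ (_%:R)).
rewrite big_split /= -mulr_sumr gf_empty mulr1.
case: K K0 PK => // k k0 PK; rewrite doubleS (@crank_gf _ z P) //; last by lia.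
by ring.
Qed.

End StcrankGF.

(** * Clearing the denominator at a fifth root of unity *)

Section FiveDissection.

Variables (A : comUnitRingType) (q z e : A) (K : nat).
Hypothesis qK : q ^+ K = 0.
Hypotheses (z5 : z ^+ 5 = 1) (zsum : 1 + z + z ^+ 2 + z ^+ 3 + z ^+ 4 = 0).
Hypothesis (e2 : e ^+ 2 = 1).
Local Notation P := (q ^+ 4).
Local Notation Q := (e * q ^+ 2).
Local Notation t := (e * z).

Lemma z_unit : z \is a GRing.unit.
Proof. by apply/unitrPr; exists (z ^+ 4); rewrite -exprS. Qed.

Lemma e_unit : e \is a GRing.unit.
Proof. by apply/unitrPr; exists e; rewrite -expr2. Qed.

Lemma zV : z^-1 = z ^+ 4.
Proof. by apply: (mulrI z_unit); rewrite mulrV ?z_unit // -exprS z5. Qed.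

Lemma tV : t^-1 = e * z ^+ 4.
Proof.
rewrite invrM ?e_unit ?z_unit // zV mulrC; congr (_ * _).
by apply: (mulrI e_unit); rewrite mulrV ?e_unit // -expr2.
Qed.

Lemma t_unit : t \is a GRing.unit.
Proof. by rewrite unitrM e_unit z_unit. Qed.

Lemma Qnil : Q ^+ K = 0.
Proof. by rewrite mul_nil // exp_nil. Qed.

Lemma qpoch_even_odd (a w : A) n :
  qpoch a w n.*2 = qpoch a (w ^+ 2) n * qpoch (a * w) (w ^+ 2) n.
Proof.
elim: n => [|n IH]; first by rewrite !qpoch0 mulr1.
have -> : qpoch a w n.+1.*2 =
    qpoch a w n.*2 * (1 - a * w ^+ n.*2) * (1 - a * w ^+ n.*2.+1) by rewrite !qpochS.
rewrite IH !qpochS -exprM mul2n [w ^+ n.*2.+1]exprS; ring.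
Qed.

(** [z + z ^+ 4] and [z ^+ 2 + z ^+ 3] have sum and product [-1]. *)
Lemma five_factors (y : A) :
  (1 - z * y) * (1 - z ^+ 4 * y) * ((1 - y) * (1 - z ^+ 2 * y) * (1 - z ^+ 3 * y))
  = 1 - y ^+ 5.
Proof.
pose r := z + z ^+ 4; pose r' := z ^+ 2 + z ^+ 3.
have rr : r' = - 1 - r.
  by apply/eqP; rewrite -subr_eq0 -zsum /r /r'; apply/eqP; ring.
have rr' : r * r' = - 1.
  have -> : r * r' = z ^+ 3 + z ^+ 4 + z ^+ 5 * (z + z ^+ 2) by rewrite /r /r'; ring.
  by rewrite z5 mul1r; apply/eqP; rewrite -subr_eq0 -zsum; apply/eqP; ring.
have -> : (1 - z * y) * (1 - z ^+ 4 * y) = 1 - r * y + y ^+ 2.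
  by transitivity (1 - r * y + z ^+ 5 * y ^+ 2); [rewrite /r; ring | rewrite z5 mul1r].
have -> : (1 - y) * (1 - z ^+ 2 * y) * (1 - z ^+ 3 * y) = (1 - y) * (1 - r' * y + y ^+ 2).
  by transitivity ((1 - y) * (1 - r' * y + z ^+ 5 * y ^+ 2));
    [rewrite /r'; ring | rewrite z5 mul1r].
transitivity ((1 - y) * (1 - (r + r') * y + (2 + r * r') * y ^+ 2 - (r + r') * y ^+ 3 + y ^+ 4)).
  by ring.
by rewrite rr' rr; ring.
Qed.

Lemma qpoch_five n :
  qpoch (z * Q) Q n * qpoch (z ^+ 4 * Q) Q n *
    (qpoch Q Q n * qpoch (z ^+ 2 * Q) Q n * qpoch (z ^+ 3 * Q) Q n)
  = qpoch (Q ^+ 5) (Q ^+ 5) n.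
Proof.
rewrite /qpoch -!big_split; apply: eq_bigr => i _ /=.
have -> : Q ^+ 5 * (Q ^+ 5) ^+ i = (Q * Q ^+ i) ^+ 5.
  by rewrite -!exprS -!exprM mulnC.
rewrite -five_factors; ring.
Qed.

(** The sum of [q^(2 d^2 + d)] over all integers [d], the first sum running over
[- d] and the second over [d + 1]; further terms are truncated. *)
Definition theta_a : A :=
  \sum_(d < K.*2.+1) q ^+ d * P ^+ 'C(d, 2)
  + \sum_(d < K.*2) (q ^+ 3) ^+ d.+1 * P ^+ 'C(d.+1, 2).

Definition theta_b : A :=
  \sum_(m < K.*2) (-1) ^+ m * (z ^+ m.*2 - z ^+ (3 * m.+1)) * Q ^+ 'C(m.+1, 2).

Lemma theta_aE : theta_a = qpoch P P K * (qpoch (- q) P K * qpoch (- q ^+ 3) P K).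
Proof.
have qq : q * q ^+ 3 = P by rewrite -exprS.
have PK : P ^+ K = 0 by exact: exp_nil.
rewrite /theta_a -qq -triple_product ?qq //; congr (_ * (_ * _)).
  by apply: eq_bigr => l _; rewrite mulNr opprK.
by apply: eq_bigr => l _; rewrite mulNr opprK.
Qed.

(** The triple product with [u = - z ^+ 3] and [v = - z ^+ 2 * Q]; the factor
[1 - z ^+ 3] comes from the first factor in [u].  The sums over powers of [u] and
of [v] are merged by equal powers of [Q]. *)
Lemma theta_bE : theta_b =
  (1 - z ^+ 3) * (qpoch Q Q K * qpoch (z ^+ 2 * Q) Q K * qpoch (z ^+ 3 * Q) Q K).
Proof.
pose u := - z ^+ 3; pose v := - (z ^+ 2 * Q).
have uv : u * v = Q.
  by transitivity (z ^+ 5 * Q); [rewrite /u /v; ring | rewrite z5 mul1r].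
have := @triple_product A u v K; rewrite uv => /(_ Qnil).
have -> : \prod_(l < K) (1 + u * Q ^+ l) = (1 - z ^+ 3) * qpoch (z ^+ 3 * Q) Q K.
  transitivity (qpoch (z ^+ 3) Q K); first by apply: eq_bigr => l _; rewrite mulNr.
  by rewrite -qpochSl (@qpoch_stable _ _ _ K K.+1) // Qnil.
have -> : \prod_(l < K) (1 + v * Q ^+ l) = qpoch (z ^+ 2 * Q) Q K.
  by apply: eq_bigr => l _; rewrite mulNr.
move=> tp; transitivity (qpoch Q Q K *
  ((1 - z ^+ 3) * qpoch (z ^+ 3 * Q) Q K * qpoch (z ^+ 2 * Q) Q K)); last by ring.
rewrite {}tp big_ord_recl expr0 mul1r expr0.
pose b m := (-1) ^+ m * z ^+ m.*2 * Q ^+ 'C(m.+1, 2).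
have vE m : v ^+ m.+1 * Q ^+ 'C(m.+1, 2) = b m.+1.
  have -> : v = (-1 * z ^+ 2) * Q by rewrite /v; ring.
  rewrite /b [(_ * Q) ^+ _]exprMn [(-1 * _) ^+ _]exprMn -[(z ^+ 2) ^+ _]exprM mul2n.
  by rewrite ['C(m.+2, 2)]binS bin1 [Q ^+ (_ + _)]exprD; ring.
under [X in _ = _ + X]eq_bigr => m _ do rewrite vE.
(* The two sums have lengths [2K + 1] and [2K]; the extra term is truncated. *)
have bK : b K.*2 = 0.
  rewrite /b (expr_nil Qnil) ?mulr0 // binS bin1 -addnn addnA leq_addl //.
have -> : 1 + \sum_(i < K.*2) u ^+ lift ord0 i * Q ^+ 'C(lift ord0 i, 2) + \sum_(m < K.*2) b m.+1
   = \sum_(m < K.*2) b m + \sum_(i < K.*2) u ^+ i.+1 * Q ^+ 'C(i.+1, 2).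
  rewrite addrAC addrC [LHS]addrC; congr (_ + _).
  transitivity (\sum_(m < K.*2.+1) b m); last by rewrite big_ord_recr /= bK addr0.
  by rewrite big_ord_recl /b !mul1r expr0.
rewrite -big_split; apply: eq_bigr => m _ /=.
have -> : u ^+ m.+1 = - ((-1) ^+ m * z ^+ (3 * m.+1)).
  by rewrite /u [LHS]exprNn -exprM [(-1) ^+ m.+1]exprS; ring.
by rewrite /b; ring.
Qed.

(** The four denominators interlace: those in [q ^+ 4] are the even powers of [Q]
and those in [q ^+ 2 * q ^+ 4j] are the odd ones. *)
Lemma five_dissection :
  qpoch P P K / (qpoch (z * P) P K * qpoch (z^-1 * P) P K) * gf_no_repeats q t K
   * qpoch (Q ^+ 5) (Q ^+ 5) K * (1 - z ^+ 3)
  = theta_a * theta_b.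
Proof.
pose D := qpoch (z * Q) Q K.*2 * qpoch (z ^+ 4 * Q) Q K.*2.
have Q2 : Q ^+ 2 = P by rewrite exprMn e2 mul1r -exprM.
have PK : P ^+ K = 0 by exact: exp_nil.
have DE : D = qpoch (z * P) P K * qpoch (z^-1 * P) P K *
    (qpoch (t^-1 * q ^+ 2) P K * qpoch (t * q ^+ 2) P K).
  have QQ c : c * Q * Q = c * P by rewrite -mulrA -expr2 Q2.
  rewrite /D !qpoch_even_odd Q2 !QQ zV tV.
  have -> : e * z ^+ 4 * q ^+ 2 = z ^+ 4 * Q by ring.
  have -> : t * q ^+ 2 = z * Q by ring.
  ring.
have u c n : (0 < n)%N -> qpoch (c * q ^+ n) P K \is a GRing.unit.
  by move=> n0; apply: (@qpoch_unit _ _ _ K); rewrite mul_nil // exp_nil.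
transitivity (qpoch P P K * (qpoch (- q) P K * qpoch (- q ^+ 3) P K) / D *
   (D * theta_b)); last first.
  rewrite theta_aE mulrA mulrVK // DE !unitrM.
  by rewrite !u.
have -> : D * theta_b = qpoch (Q ^+ 5) (Q ^+ 5) K * (1 - z ^+ 3).
  rewrite theta_bE -qpoch_five /D !(@qpoch_stable _ _ Q K K.*2) ?Qnil //; last 2 first.
  - by rewrite -addnn leq_addr.
  - by rewrite -addnn leq_addr.
  by ring.
rewrite /gf_no_repeats DE [(_ * _ * (_ * _))^-1]invrM ?unitrM ?u //.
by ring.
Qed.

End FiveDissection.

(** * Coefficients in truncated power series *)

Section Coefficient.

Variables (F : fieldType) (N : nat).
Local Notation K := N.+1.
Local Notation A := {poly %/ ('X^K : {poly F})}.
Definition qvar : A := in_qpoly 'X^K 'X.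
Local Notation q := qvar.

(** The coefficient of [X^N], the last one that is not truncated. *)
Definition top_coef (a : A) : F := (a : {poly F})`_N.

Lemma qvar_pow n : q ^+ n = in_qpoly 'X^K 'X^n.
Proof. by rewrite rmorphXn. Qed.

Lemma qvar_nil : q ^+ K = 0.
Proof.
rewrite qvar_pow; apply: val_inj => /=.
by rewrite mk_monic_Xn /= Pdiv.RingMonic.rmodpp ?monicXn.
Qed.

Lemma top_coefD a b : top_coef (a + b) = top_coef a + top_coef b.
Proof. by rewrite /top_coef poly_of_qpolyD coefD. Qed.

Lemma top_coefZ c a : top_coef (c *: a) = c * top_coef a.
Proof. by rewrite /top_coef poly_of_qpolyZ coefZ. Qed.

Lemma top_coef0 : top_coef 0 = 0.
Proof. by rewrite /top_coef coef0. Qed.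

Lemma top_coef_sum I (r : seq I) (Q : pred I) (G : I -> A) :
  top_coef (\sum_(i <- r | Q i) G i) = \sum_(i <- r | Q i) top_coef (G i).
Proof. exact: (big_morph _ top_coefD top_coef0). Qed.

Lemma top_coefX n : top_coef (q ^+ n) = (n == N)%:R.
Proof.
have [nK|Kn] := ltnP n K; last first.
  by rewrite (expr_nil qvar_nil Kn) top_coef0 gtn_eqF.
rewrite /top_coef qvar_pow in_qpoly_small ?coefXn 1?eq_sym //.
by rewrite mk_monic_Xn !size_polyXn ltnS.
Qed.

Hypothesis N4 : (N %% 5 = 4)%N.

(** [N] being 4 mod 5, this says that the coefficients of all [X^i] with [i] equal
to 4 mod 5 are zero.  Testing the last coefficient of the products by powers of
[q ^+ 5] makes stability under series in [q ^+ 5] immediate. *)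
Definition vanishing (a : A) := forall k, top_coef (q ^+ (5 * k) * a) = 0.

Lemma vanishingD a b : vanishing a -> vanishing b -> vanishing (a + b).
Proof. by move=> va vb k; rewrite mulrDr top_coefD va vb addr0. Qed.

Lemma vanishingZ c a : vanishing a -> vanishing (c *: a).
Proof. by move=> va k; rewrite -scalerAr top_coefZ va mulr0. Qed.

Lemma vanishing0 : vanishing 0.
Proof. by move=> k; rewrite mulr0 top_coef0. Qed.

Lemma vanishing_sum I (r : seq I) (Q : pred I) (G : I -> A) :
  (forall i, Q i -> vanishing (G i)) -> vanishing (\sum_(i <- r | Q i) G i).
Proof. exact: (big_ind vanishing vanishing0 vanishingD). Qed.

Lemma vanishing_shift n a : vanishing a -> vanishing (q ^+ (5 * n) * a).
Proof. by move=> va k; rewrite mulrA -exprD -mulnDr va. Qed.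

Lemma vanishingX n : (n %% 5 != 4)%N -> vanishing (q ^+ n).
Proof.
move=> n4 k; rewrite -exprD top_coefX; case: eqP => // e.
by have := N4; rewrite -e mulnC modnMDl => n4'; rewrite n4' in n4.
Qed.

(** The inverse of [1 - w ^+ m.+1] is a geometric series in a power of [q ^+ 5]. *)
Lemma vanishing_div c n m a : (0 < n)%N -> vanishing a ->
  vanishing (a / qpoch (c%:A * q ^+ (5 * n)) (c%:A * q ^+ (5 * n)) m).
Proof.
move=> n0 va; set w := c%:A * _.
have wK : w ^+ K = 0 by rewrite mul_nil // exp_nil ?qvar_nil // muln_gt0.
elim: m => [|m IH]; first by rewrite qpoch0 divr1.
rewrite qpochS -exprS invrM; last 2 first.
- by apply: qpoch_unit wK.
- by apply: (@unit_sub_nil _ _ K); apply: exp_nil.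
rewrite mulrCA (@inv_sub_nil _ _ K); last exact: exp_nil.
rewrite mulr_suml; apply: vanishing_sum => i _.
have -> : w ^+ m.+1 ^+ i = c ^+ (m.+1 * i) *: q ^+ (5 * (n * (m.+1 * i))).
  rewrite -exprM /w mulr_algl exprZn -exprM.
  by rewrite !mulnA.
by rewrite -scalerAl; apply: vanishingZ; apply: vanishing_shift.
Qed.

Variables (zeta e : F).
Hypotheses (z5 : zeta ^+ 5 = 1) (zeta1 : zeta != 1) (e2 : e ^+ 2 = 1).
Local Notation z := (zeta%:A : A).
Local Notation eA := (e%:A : A).

(** [2 d^2 + d] is 0, 1 or 3 mod 5 and [m (m + 1)] is 0, 1 or 2, with 1 only for
[m = 2] mod 5; the sum is 4 only as [3 + 1]. *)
Lemma vanishing_theta :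
  vanishing (theta_a q N.+1 * theta_b q z eA N.+1).
Proof.
have key d m : (d %% 5 = 0 \/ d %% 5 = 1 \/ d %% 5 = 3)%N ->
   vanishing (q ^+ d * ((-1) ^+ m * (z ^+ m.*2 - z ^+ (3 * m.+1))
                        * (eA * q ^+ 2) ^+ 'C(m.+1, 2))).
  move=> d5.
  have -> : (-1) ^+ m * (z ^+ m.*2 - z ^+ (3 * m.+1))
      = ((-1) ^+ m * (zeta ^+ m.*2 - zeta ^+ (3 * m.+1)))%:A.
    by rewrite -[RHS]/(in_alg A _) rmorphM rmorphXn rmorphN1 rmorphB !rmorphXn.
  have -> : (eA * q ^+ 2) ^+ 'C(m.+1, 2) = (e ^+ 'C(m.+1, 2))%:A * q ^+ (m * m.+1).
    rewrite exprMn -exprM; congr (_ * q ^+ _); last first.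
      by rewrite -(mul_bin_diag m.+1 1) bin1 mulnC.
    by rewrite -[RHS]/(in_alg A _) rmorphXn.
  rewrite mulr_algl -!scalerAl mul1r -!scalerAr -exprD.
  (* If [m] is 2 mod 5, both powers of [zeta] are [zeta ^+ 4]. *)
  have [m5|m5] := eqVneq (m %% 5)%N 2%N.
    rewrite -(expr_mod m.*2 z5) -(expr_mod (3 * m.+1) z5).
    have -> : (m.*2 %% 5 = 4)%N by lia.
    have -> : ((3 * m.+1) %% 5 = 4)%N by lia.
    by rewrite subrr mulr0 scale0r; exact: vanishing0.
  do 2!apply: vanishingZ; apply: vanishingX.
  have : (m * m.+1 %% 5 = 0 \/ m * m.+1 %% 5 = 2)%N.
    have m5' : (m %% 5 < 5)%N by rewrite ltn_mod.
    rewrite -modnMml -modnMmr -[m.+1]addn1 -[((m + 1) %% 5)%N]modnDml.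
    by case: (m %% 5)%N m5 m5' => [|[|[|[|[|?]]]]] //= _ _; [left|right|right|left].
  by rewrite -modnDm; move=> [] ->; case: d5 => [->|[->|->]].
have term d m : (d %% 5 = 0 \/ d %% 5 = 1 \/ d %% 5 = 3)%N -> forall a, a = q ^+ d ->
  vanishing (a * ((-1) ^+ m * (z ^+ m.*2 - z ^+ (3 * m.+1))
                        * (eA * q ^+ 2) ^+ 'C(m.+1, 2))).
  by move=> d5 a ->; exact: key.
have theta_exp c d : (c = 1 \/ c = 3)%N ->
    let r := ((c * d.+1 + 4 * 'C(d.+1, 2)) %% 5)%N in (r = 0 \/ r = 1 \/ r = 3)%N.
  move=> c13; have -> : (4 * 'C(d.+1, 2) = 2 * (d.+1 * d))%N.
    by rewrite -[(2 * (_ * d))%N]/(2 * (d.+1 * d.+1.-1))%N -{3}[d]bin1 mul_bin_diag mulnA.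
  rewrite (divn_eq d 5); have : (d %% 5 < 5)%N by rewrite ltn_mod.
  move: (d %/ 5)%N (d %% 5)%N => k r r5.
  have -> : (c * (k * 5 + r).+1 + 2 * ((k * 5 + r).+1 * (k * 5 + r)) =
    (c * k + 2 * (k * (k * 5 + r) + r.+1 * k)) * 5 + (c * r.+1 + 2 * (r.+1 * r)))%N by nia.
  rewrite modnMDl /=; case: c13 => ->.
    by case: r r5 => [|[|[|[|[|?]]]]] //= _; auto.
  by case: r r5 => [|[|[|[|[|?]]]]] //= _; auto.
rewrite /theta_a /theta_b mulrDl; apply: vanishingD; rewrite big_distrlr /=;
  apply: vanishing_sum => d _; apply: vanishing_sum => m _.
  apply: (@term (1 * d + 4 * 'C(d, 2))%N); last by rewrite mul1n -exprM -exprD.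
  by case: (val d) => [|d'] /=; [left | apply: theta_exp; left].
apply: (@term (3 * d.+1 + 4 * 'C(d.+1, 2))%N); last by rewrite -!exprM -exprD.
by apply: theta_exp; right.
Qed.

Lemma scalar_pow c n : (c%:A : A) ^+ n = (c ^+ n)%:A.
Proof. by rewrite -[RHS]/(in_alg A _) rmorphXn. Qed.

Lemma zeta_sum : 1 + zeta + zeta ^+ 2 + zeta ^+ 3 + zeta ^+ 4 = 0.
Proof.
have : (zeta - 1) * (1 + zeta + zeta ^+ 2 + zeta ^+ 3 + zeta ^+ 4) = 0.
  by transitivity (zeta ^+ 5 - 1); [ring | rewrite z5 subrr].
by move/eqP; rewrite mulf_eq0 subr_eq0 (negbTE zeta1) => /eqP.
Qed.

Lemma zA5 : z ^+ 5 = 1.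
Proof. by rewrite scalar_pow z5 scale1r. Qed.

Lemma zA_sum : 1 + z + z ^+ 2 + z ^+ 3 + z ^+ 4 = 0.
Proof.
rewrite !scalar_pow -{1}[1]scale1r -!scalerDl zeta_sum scale0r //.
Qed.

Lemma eA2 : eA ^+ 2 = 1.
Proof. by rewrite scalar_pow e2 scale1r. Qed.

Lemma vanishing_stcrank :
  vanishing (\sum_(p <- partitions 0 K.*2.*2 K.*2)
    (z ^ (crank (pi_one p)) + (z - 1) * (q ^+ 4) * (pi_one p == [::])%:R) *
    ((eA * z) ^ (half_srank false p) * q ^+ sumn p)).
Proof.
have zu := z_unit zA5; have eu := e_unit eA2.
rewrite (gf_stcrank zu (t_unit zA5 eA2) (ltn0Sn N) qvar_nil).
set R := (X in vanishing X).
have := five_dissection qvar_nil zA5 zA_sum eA2; rewrite -/R.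
have -> : (eA * q ^+ 2) ^+ 5 = (e ^+ 5)%:A * q ^+ (5 * 2).
  by rewrite exprMn scalar_pow -exprM.
set w := (e ^+ 5)%:A * _ => RE.
have wu : qpoch w w K \is a GRing.unit.
  by apply: (@qpoch_unit _ _ _ K); rewrite mul_nil // exp_nil // qvar_nil.
have z3 : 1 - zeta ^+ 3 != 0.
  rewrite subr_eq0 eq_sym; apply: contra zeta1 => /eqP z3.
  have : zeta ^+ 6 = 1 by rewrite (exprM zeta 3 2) z3 expr1n.
  by rewrite exprS z5 mulr1 => ->.
have -> : R = (1 - zeta ^+ 3)^-1 *: (theta_a q K * theta_b q z eA K / qpoch w w K).
  rewrite -RE mulrAC mulrK // scalar_pow.
  have -> : 1 - (zeta ^+ 3)%:A = (1 - zeta ^+ 3)%:A :> A by rewrite scalerBl scale1r.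
  by rewrite [R * _]mulrC mulr_algl scalerA mulVf // scale1r.
by apply: vanishingZ; apply: vanishing_div => //; exact: vanishing_theta.
Qed.

Lemma scalar_powz c n : c != 0 -> (c%:A : A) ^ n = (c ^ n)%:A.
Proof. by move=> c0; rewrite -[RHS]/(in_alg A _) rmorphXz // unitfE. Qed.

(** The last coefficient of the series in [vanishing_stcrank]; the factor [q ^+ 4]
moves the correction term to the partitions of [N - 4]. *)
Lemma stcrank_sum_parts :
  \sum_(p <- partitions 0 K.*2.*2 K.*2 | sumn p == N)
     zeta ^ (crank (pi_one p)) * (e * zeta) ^ (half_srank false p)
  + (zeta - 1) * \sum_(p <- partitions 0 K.*2.*2 K.*2 | (sumn p + 4 == N)%N && (pi_one p == [::]))
     (e * zeta) ^ (half_srank false p) = 0.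
Proof.
have z0 : zeta != 0 by apply: contra_eqN z5 => /eqP ->; rewrite expr0n eq_sym oner_eq0.
have e0 : e != 0 by apply: contra_eqN e2 => /eqP ->; rewrite expr0n eq_sym oner_eq0.
have := vanishing_stcrank 0; rewrite muln0 expr0 mul1r top_coef_sum => h.
rewrite -[RHS]h {h}.
rewrite mulr_sumr [X in X + _]big_mkcond [X in _ + X]big_mkcond -big_split; apply: eq_bigr => p _ /=.
have -> : eA * z = (e * zeta)%:A by rewrite -[RHS]/(in_alg A _) rmorphM.
rewrite !scalar_powz ?mulf_neq0 //.
set x := zeta ^ _; set y := (e * zeta) ^ _.
have -> : (x%:A + (z - 1) * q ^+ 4 * (pi_one p == [::])%:R) * (y%:A * q ^+ sumn p)
  = (x * y) *: q ^+ sumn p + ((zeta - 1) * (pi_one p == [::])%:R * y) *: q ^+ (sumn p + 4).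
  have -> : z - 1 = (zeta - 1)%:A by rewrite scalerBl scale1r.
  have -> : (pi_one p == [::])%:R = ((pi_one p == [::])%:R%:A : A) by rewrite scaler_nat.
  have algM a b : (a * b)%:A = a%:A * b%:A :> A.
    by rewrite -[LHS]/(in_alg A _) rmorphM.
  have algZ c (a : A) : c *: a = c%:A * a by rewrite mulr_algl.
  rewrite (algZ (x * y)) (algZ ((zeta - 1) * _ * y)) !algM exprD.
  by move: (x%:A) (y%:A) ((zeta - 1)%:A) (_%:R%:A) => *; ring.
rewrite top_coefD !top_coefZ !top_coefX.
by case: (sumn p == N); case: (sumn p + 4 == N)%N; case: (pi_one p == [::]);
  rewrite /= ?(mulr0, mul0r, mulr1, addr0, add0r).
Qed.

End Coefficient.

(** * Partitions of a given integer *)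

Section PartitionEnum.

Implicit Types (p : seq nat) (n K : nat).

Lemma partitions_uniq a n K : uniq (partitions a n K).
Proof.
elim: n => //= n IH; apply: allpairs_uniq => //; first exact: iota_uniq.
move=> [f p] [g r] /= /allpairsP[[f1 p1] /= [_ p1P [-> ->]]].
move=> /allpairsP[[g1 r1] /= [_ r1P [-> ->]]].
have cnt0 s : s \in partitions a n K -> count_mem (a + n.+1)%N s = 0%N.
  move=> /partitions_bound sP; apply/eqP; rewrite -leqn0 leqNgt -has_count.
  by apply/hasPn => x /(allP sP) /= xP; apply/eqP => xe; rewrite xe in xP; lia.
move=> e; have fg : f1 = g1.
  have := congr1 (count_mem (a + n.+1)%N) e.
  by rewrite !count_cat !count_nseq /= eqxx !mul1n !cnt0 // !addn0.
by move/eqP: e; rewrite fg eqseq_cat // eqxx /= => /eqP ->.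
Qed.

Lemma partition_split m p : is_partition p -> (largest p <= m.+1)%N ->
  p = nseq (mult p m.+1) m.+1 ++ [seq x <- p | x != m.+1].
Proof.
elim: p => // x p IH; rewrite partition_cons => /and3P[x0 px pP] /= xm.
rewrite {1}(IH pP (leq_trans px xm)) /mult /=.
have [->|xm'] := eqVneq x m.+1; first by [].
by rewrite -/(mult p m.+1) mult_largest //= ; lia.
Qed.

Lemma partition_filter (a : pred nat) p : is_partition p -> is_partition (filter a p).
Proof.
case/andP => ps p0; rewrite /is_partition (sorted_filter geq_trans) //=.
by rewrite mem_filter negb_and p0 orbT.
Qed.

Lemma mem_partitions n K p : is_partition p -> (largest p <= n)%N ->
  (forall x, mult p x < K)%N -> p \in partitions 0 n K.
Proof.
elim: n p => [|n IH] p pP pn pK.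
  by case: p pP pn {pK} => // x p; rewrite partition_cons /= => /andP[x0 _]; lia.
rewrite (partition_split pP pn) /=; apply/allpairsP.
exists (mult p n.+1, [seq x <- p | x != n.+1]); split=> //=.
  by rewrite mem_iota pK.
have fP := partition_filter (fun x => x != n.+1) pP.
apply: IH => // [|x]; last first.
  apply: leq_ltn_trans (pK x); rewrite /mult -size_filter -filter_predI size_filter.
  by apply: sub_count => y /= /andP[].
case E : (filter _ p) => [|x s] //=.
have : x \in [seq x <- p | x != n.+1] by rewrite E mem_head.
rewrite mem_filter => /andP[xn xp].
by have := allP (largest_max pP) _ xp; lia.
Qed.

Lemma sum_intpartn (V : nmodType) n (Q : pred (seq nat)) (G : seq nat -> V) :
  \sum_(x : intpartn n | Q x) G x =
  \sum_(p <- [seq val x | x <- enum {: intpartn n}] | Q p) G p.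
Proof. by rewrite big_map big_enum_cond. Qed.

Lemma mem_enum_intpartn n p :
  (p \in [seq val x | x <- enum {: intpartn n}]) = is_partition_of n p.
Proof.
apply/mapP/idP => [[[r rP] _ ->] //|pP].
by exists (IntPartn pP); rewrite ?mem_enum.
Qed.

Lemma uniq_enum_intpartn n : uniq [seq val x | x <- enum {: intpartn n}].
Proof. by rewrite map_inj_uniq ?enum_uniq //; exact: val_inj. Qed.

(** Within the bounds, [partitions] lists every partition of [n] exactly once. *)
Lemma sum_partitions_intpartn (V : nmodType) n m K (Q : pred (seq nat)) (G : seq nat -> V) :
  (n <= m)%N -> (n < K)%N ->
  \sum_(p <- partitions 0 m K | (sumn p == n) && Q p) G p =
  \sum_(x : intpartn n | Q x) G x.
Proof.
move=> nm nK; rewrite sum_intpartn -big_filter_cond; apply: perm_big.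
apply: uniq_perm; rewrite ?uniq_enum_intpartn ?filter_uniq ?partitions_uniq // => p.
rewrite mem_filter mem_enum_intpartn /is_partition_of andbC.
case: eqP => [pn|_]; rewrite ?andbT ?andbF //; apply/idP/idP; first exact: partitions_partition.
move=> pP; have p0 : 0%N \notin p by case/andP: pP.
apply: mem_partitions => // [|x].
  apply: leq_trans nm; rewrite -pn; case: (p) => //= x r; exact: leq_addr.
by apply: leq_ltn_trans nK; rewrite -pn (leq_trans (count_size _ _)) // size_leq_sumn.
Qed.

End PartitionEnum.

(** * Partitions of type B *)

Section TypeB.

Implicit Types (p : seq nat) (n l : nat).

(** Adds 2 to the first row and 2 to the first column.  The empty partition has
neither; its image is the exceptional partition of type B. *)
Definition add_hook p : seq nat :=
  if p is l :: p' then l.+2 :: p' ++ [:: 1; 1]%N else [:: 3; 1]%N.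

Lemma half_srank_cat11 s p : half_srank s (p ++ [:: 1; 1]%N) = half_srank s p + 1.
Proof. by elim: p s => [|l p IH] s; rewrite /= ?IH ?addrA //; case: s. Qed.

(** The first row gains one cell of each kind that counts [-1] and 0, and of the two
new rows of length 1 exactly one counts 1. *)
Lemma half_srank_add_hook p : half_srank false (add_hook p) = half_srank false p.
Proof.
by case: p => [|l p] //=; rewrite half_srank_cat11; lia.
Qed.

Lemma sumn_add_hook p : sumn (add_hook p) = (sumn p + 4)%N.
Proof. by case: p => [|l p] //=; rewrite sumn_cat /=; lia. Qed.

Lemma partition_cat11 p : is_partition p -> is_partition (p ++ [:: 1; 1]%N).
Proof.
elim: p => // l p IH; rewrite cat_cons !partition_cons => /and3P[l0 pl pP].
by rewrite l0 IH // andbT; case: p pl {pP IH}.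
Qed.

Lemma partition_add_hook p : is_partition p -> is_partition (add_hook p).
Proof.
case: p => // l p; rewrite /add_hook !partition_cons => /and3P[l0 pl pP].
by rewrite partition_cat11 // andbT /=; case: p pl {pP} => //= x p; lia.
Qed.

Lemma add_hook_inj : injective add_hook.
Proof.
have nil l p : add_hook (l :: p) <> [:: 3; 1]%N.
  by move/(congr1 size); rewrite /= size_cat /= addn2.
case=> [|l p] [|k r] // e; first by case: (nil k r).
  by case: (nil l p).
case: e => -> /(congr1 (fun s => take (size s - 2) s)).
by rewrite !size_cat !addnK !take_size_cat // => ->.
Qed.

Lemma conj_part12 p : is_partition p -> (1 < largest p)%N ->
  part (conj_partition p) 1 = count (leq 1) p /\
  part (conj_partition p) 2 = count (leq 2) p.
Proof.
move=> pP p1; rewrite conj_partitionE // /part.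
by case: (largest p) p1 => [|[|k]].
Qed.

Lemma largest_cat11 l p : (0 < l)%N -> (largest p <= l)%N ->
  (largest (p ++ [:: 1; 1]%N) <= l)%N.
Proof. by case: p. Qed.

Lemma type_B_add_hook p : is_partition p -> no_repeated_even_parts p ->
  type_B (add_hook p).
Proof.
case: p => [_ _|l p]; first by rewrite /type_B orbT.
move=> lpP; have aP := partition_add_hook lpP.
have := lpP; rewrite partition_cons => /and3P[l0 pl pP] nr.
have hl := largest_cat11 l0 pl; have pmax := allP (largest_max pP).
have large x : x \in p -> (x <= l)%N by move/pmax => xl; exact: leq_trans xl pl.
have [c1 c2] := @conj_part12 (add_hook (l :: p)) aP (isT).
rewrite /type_B; apply/orP; left; rewrite c1 c2 sumn_add_hook /part.
have -> : nth 0%N (add_hook (l :: p)) 1 = largest (p ++ [:: 1; 1]%N) by case: (p).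
rewrite /= ; apply/and5P; split.
- by lia.
- by lia.
- rewrite !count_cat /= !addn0.
  have c12 : (count (leq 2) p <= count (leq 1) p)%N by apply: sub_count => x /=; lia.
  by lia.
- apply/allP => x; rewrite inE mem_cat => xq.
  case: (boolP (odd x)) => //= ex; rewrite /mult /= count_cat /= addn0.
  have x1 : (1%N == x) = false by apply/eqP => x1; rewrite -x1 in ex.
  rewrite x1 !addn0; case/or3P: xq => [/eqP ->|xp|].
  + by rewrite eqxx -/(mult p l.+2) mult_largest //; lia.
  + have := allP nr x; rewrite inE xp orbT => /(_ isT).
    rewrite (negbTE ex) /mult /= => mx; have := large x xp.
    by case: (l.+2 =P x) => [<-|_] //; lia.
  + by rewrite !inE => /orP[] /eqP e; rewrite e in x1.
apply/negP => /andP[/eqP e el]; have el' : largest (p ++ [:: 1; 1]%N) = l by lia.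
rewrite el' in el; have lp : l \in p.
  case: (p) el' => [|x r] /= e'; last by rewrite e' mem_head.
  by rewrite -e' in el.
have := allP nr l; rewrite mem_head => /(_ isT).
rewrite (negbTE el) /= /mult /= eqxx; have : (0 < count_mem l p)%N by rewrite -has_count has_pred1.
by rewrite -[nat_of_bool true]/1%N; case: (count_mem l p).
Qed.

Lemma partition_ones q : is_partition q ->
  exists2 x, q = x ++ nseq (count_mem 1%N q) 1%N & all (leq 2) x.
Proof.
elim: q => [|l q IH]; first by exists [::].
rewrite partition_cons => /and3P[l0 ql /[dup] qP /IH[x qE x2]].
have [l1|l1] := eqVneq l 1%N; last first.
  exists (l :: x); last by rewrite /= x2 andbT; lia.
  by rewrite /= (negbTE l1) add0n -qE.
exists [::] => //; rewrite l1.
rewrite -[count_mem _ _]/(1 + count_mem 1 q)%N add1n /=; congr cons.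
case: x qE x2 => [|y x] // qE /= /andP[y2 _].
by move: ql; rewrite qE /= l1; lia.
Qed.

(** The gap between the first two columns provides two parts 1 to remove, and the gap
between the first two rows keeps the shortened first row first.  The last clause
of type B prevents the shortened row from repeating an even part. *)
Lemma type_B_add_hook_inv q : is_partition q -> type_B q ->
  exists p, [/\ is_partition p, no_repeated_even_parts p & q = add_hook p].
Proof.
move=> qP; case/orP => [/and5P[_ q12 c12 nr ne]|/eqP ->]; last by exists [::].
case: q qP q12 c12 nr ne => // l r qP; rewrite {1 2}/part /= => q12.
have l2 : (1 < l)%N by lia.
have [-> ->] := @conj_part12 (l :: r) qP l2 => c12 nr ne.
have := qP; rewrite partition_cons => /and3P[l0 rl rP].
have [x rE x2] := partition_ones rP.
have f2 : (1 < count_mem 1%N r)%N.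
  move: c12; rewrite /= l2 l0; rewrite {1 2}rE !count_cat !count_nseq /= mul0n mul1n.
  have -> : count (leq 2) x = size x by apply/eqP; rewrite -all_count.
  have -> : count (leq 1) x = size x.
    by apply/eqP; rewrite -all_count; apply: sub_all x2 => y; lia.
  by lia.
move: f2 rE; case: (count_mem _ _) => [|[|f]] // _ rE.
have {}rE : r = (x ++ nseq f 1%N) ++ [:: 1; 1]%N.
  by rewrite rE -catA; congr (_ ++ _); rewrite -[f.+2]addn2 nseqD.
set p := x ++ nseq f 1%N in rE.
have sub y : y \in p -> y \in r by move=> yp; rewrite rE mem_cat yp.
have multp y : (1 < y)%N -> mult r y = mult p y.
  by move=> y1; rewrite /mult rE count_cat /= !addn0; case: eqP y1 => [<-|_] //; rewrite addn0.
have pr : (largest p <= largest r)%N by rewrite rE; case: (p).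
have pP : is_partition p.
  by move: rP; rewrite rE /is_partition mem_cat negb_or => /andP[/cat_sorted2[-> _] /andP[->]].
have r0 : (0 < largest r)%N.
  by rewrite rE; case: (p) pP => // y s; rewrite partition_cons => /andP[].
have lr : nth 0%N r 0 = largest r by case: (r).
rewrite lr in q12; rewrite /part /= lr in ne.
exists ((l - 2)%N :: p); split.
- by rewrite partition_cons pP andbT; lia.
- apply/allP => y; rewrite inE => yP; case: (boolP (odd y)) => //= ey.
  have y0 : (0 < y)%N.
    case/predU1P: yP => [->|yp]; first by lia.
    by case/andP: pP => _; apply: contraNltn; rewrite leqn0 => /eqP <-.
  have y1 : (1 < y)%N by case: y y0 ey {yP} => [|[]].
  have yle : y \in p -> (mult p y <= 1)%N.
    move=> yp; have := allP nr y; rewrite inE (sub _ yp) orbT => /(_ isT).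
    rewrite (negbTE ey) /= -multp // /mult /=; exact: leq_trans (leq_addl _ _).
  rewrite /mult /= -/(mult p y); case: eqP => [ly|ly]; last first.
    by case/predU1P: yP => [yl|/yle //]; rewrite yl in ly.
  rewrite mult_largest // -ly ltn_neqAle; apply/andP; split; last by lia.
  apply: contra ne => /eqP pl; have -> : largest r = y by lia.
  by rewrite ly eqxx.
- by rewrite /add_hook rE; congr cons; lia.
Qed.

Lemma sum_type_B (V : nmodType) n (G : int -> V) :
  \sum_(x : intpartn (n + 4) | type_B x) G (half_srank false x) =
  \sum_(x : intpartn n | no_repeated_even_parts x) G (half_srank false x).
Proof.
rewrite (sum_intpartn (n + 4) (fun p => type_B p) (fun p => G (half_srank false p))).
rewrite (sum_intpartn n (fun p => no_repeated_even_parts p) (fun p => G (half_srank false p))).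
under [RHS]eq_bigr => p _ do rewrite -half_srank_add_hook.
rewrite -[RHS]big_filter -(big_map add_hook xpredT (fun p => G (half_srank false p))).
rewrite -[LHS]big_filter; apply: perm_big; apply: uniq_perm.
- by rewrite filter_uniq // uniq_enum_intpartn.
- by rewrite (map_inj_uniq add_hook_inj) filter_uniq // uniq_enum_intpartn.
move=> q; rewrite mem_filter mem_enum_intpartn; apply/andP/mapP.
  case=> qB /andP[qP /eqP qn].
  have [p [pP pN e]] := type_B_add_hook_inv qP qB; exists p => //.
  rewrite mem_filter pN mem_enum_intpartn /is_partition_of pP /=.
  by move: qn; rewrite e sumn_add_hook => /addIn ->.
case=> p; rewrite mem_filter mem_enum_intpartn => /andP[pN /andP[pP /eqP pn]] ->.
split; first exact: type_B_add_hook.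
by rewrite /is_partition_of partition_add_hook // sumn_add_hook pn eqxx.
Qed.

Lemma type_B_no_repeats p : type_B p -> no_repeated_even_parts p.
Proof. by case/orP => [/and5P[]|/eqP ->]. Qed.

End TypeB.

(** * Isolating the residues *)

Section RootsOfUnity.

Variable F : fieldType.

Lemma stcrankE p : is_partition p ->
  stcrank p = crank (pi_one p) + half_srank false p + (type_B p : nat)%:Z.
Proof. by move=> pP; rewrite /stcrank srank_double // mulzK. Qed.

(** A type B partition has an empty first component, of crank 0, so that [Psi]
replaces [1] by [zeta = 1 + (zeta - 1)] as the factor of its weight. *)
Lemma stcrank_sum n (zeta e : F) :
  zeta ^+ 5 = 1 -> zeta != 1 -> e ^+ 2 = 1 ->
  \sum_(p : intpartn (5 * n + 4)) zeta ^ stcrank p * e ^ half_srank false p = 0.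
Proof.
move=> z5 zeta1 e2; set N := (5 * n + 4)%N.
have N4 : (N %% 5 = 4)%N by rewrite /N mulnC modnMDl.
have z0 : zeta != 0 by apply: contra_eqN z5 => /eqP ->; rewrite expr0n eq_sym oner_eq0.
have e0 : e != 0 by apply: contra_eqN e2 => /eqP ->; rewrite expr0n eq_sym oner_eq0.
have NK : (N <= N.+1.*2.*2)%N by lia.
have NK' : (N < N.+1.*2)%N by lia.
pose G1 p := zeta ^ (crank (pi_one p)) * (e * zeta) ^ (half_srank false p).
pose G2 h := (e * zeta) ^ h.
have := stcrank_sum_parts N4 z5 zeta1 e2.
rewrite (eq_bigl (fun p => (sumn p == N) && predT p)) => [|p]; last by rewrite andbT.
rewrite (sum_partitions_intpartn predT G1 NK NK').
rewrite (eq_bigl (fun p => (sumn p == 5 * n)%N && (pi_one p == [::]))); last first.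
  by move=> p; rewrite /N eqn_add2r.
rewrite (@sum_partitions_intpartn _ (5 * n) _ _ (fun p => pi_one p == [::])
  (fun p => G2 (half_srank false p))); try lia.
rewrite (eq_bigl (fun x : intpartn (5 * n) => no_repeated_even_parts x)); last first.
  by move=> x; rewrite pi_one_eq0 //; case/andP: (valP x).
rewrite -sum_type_B mulr_sumr [X in _ + X]big_mkcond -big_split /= => S0.
rewrite -[RHS]S0; apply: eq_bigr => x _; have /andP[xP _] := valP x.
rewrite stcrankE // !exprzDr ?unitfE // /G1 /G2 exprzMl ?unitfE //.
case: ifP => xB; last by rewrite expr0z; ring.
have -> : pi_one x = [::] by apply/eqP; rewrite pi_one_eq0 // type_B_no_repeats.
by rewrite expr0z expr1z; ring.
Qed.

Lemma prim_root_neq0 n (w : F) : n.-primitive_root w -> w != 0.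
Proof.
move=> wp; apply: contra_eqN (prim_expr_order wp) => /eqP ->.
by rewrite expr0n gtn_eqF ?(prim_order_gt0 wp) // eq_sym oner_eq0.
Qed.

Lemma root_orthogonality n (w : F) (a : int) :
  n.-primitive_root w ->
  \sum_(j < n) (w ^+ j) ^ a = n%:R * ((a == 0 %[mod n])%Z : nat)%:R.
Proof.
move=> wp; have n0 := prim_order_gt0 wp; have w0 := prim_root_neq0 wp.
have -> : \sum_(j < n) (w ^+ j) ^ a = \sum_(j < n) (w ^ a) ^+ j.
  by apply: eq_bigr => j _; rewrite [w ^+ j]exprnP exprz_exp mulrC -exprz_exp.
have wn : (w ^ a) ^+ n = 1.
  by rewrite exprnP exprz_exp mulrC -exprz_exp -exprnP prim_expr_order // exp1rz.
have <- : (w ^ a == 1) = (a == 0 %[mod n])%Z.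
  rewrite mod0z {1}(divz_eq a n) exprzDr ?unitfE // mulrC -exprz_exp -exprnP.
  have -> : (w ^ (a %/ n)%Z) ^+ n = 1.
    by rewrite [LHS]exprnP exprz_exp mulrC -exprz_exp -exprnP prim_expr_order // exp1rz.
  rewrite mulr1.
  have : (0 <= (a %% n)%Z)%R by rewrite modz_ge0 //; lia.
  have : ((a %% n)%Z < n)%R by rewrite ltz_pmod.
  case: (a %% n)%Z => // r rn _.
  rewrite -exprnP -(prim_order_dvd wp); case: r rn => [|r]; first by rewrite dvdn0.
  by rewrite ltz_nat => rn; rewrite gtnNdvd.
have [->|wa1] := eqVneq (w ^ a) 1.
  by rewrite mulr1 (eq_bigr (fun=> 1)) => [|j _]; rewrite ?expr1n // sumr_const card_ord.
rewrite mulr0; apply: (mulfI (x := w ^ a - 1)); first by rewrite subr_eq0.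
by rewrite mulr0 -subrX1 wn subrr.
Qed.

End RootsOfUnity.

Local Close Scope ring_scope.

Theorem theorem2p2 (n i k : nat) (hi : i = 0 \/ i = 2) (hk : k < 5) :
  5 * #|[set p : intpartn (5 * n + 4) |
          (srank p == i%:Z %[mod 4])%Z && (stcrank p == k%:Z %[mod 5])%Z]|
  = p_srank i (5 * n + 4).
Proof.
have [w wp] := C_prim_root_exists (isT : 0 < 5).
have [e ep] := C_prim_root_exists (isT : 0 < 2).
set N := 5 * n + 4; pose d := Posz i./2.
have srankP (x : intpartn N) :
    (srank x == i%:Z %[mod 4])%Z = ((half_srank false x - d)%R == 0 %[mod 2])%Z.
  have /andP[xP _] := valP x; rewrite srank_double // /d.
  by case: hi => ->; apply/eqP/eqP => /=; lia.
have stcrankP (x : intpartn N) :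
    (stcrank x == k%:Z %[mod 5])%Z = ((stcrank x - k%:Z)%R == 0 %[mod 5])%Z.
  by rewrite -(eqz_modDr (- Posz k)%R) subrr.
(* Summing over [j] and [b] detects both congruences; [j = 0] detects only the one
   on the srank. *)
pose term (j : 'I_5) (b : 'I_2) (x : intpartn N) : algC :=
  ((w ^+ j) ^ (stcrank x - k%:Z) * (e ^+ b) ^ (half_srank false x - d))%R.
have inner5 (x : intpartn N) (b : 'I_2) : (\sum_(j < 5) term j b x =
    5%:R * ((stcrank x == k%:Z %[mod 5])%Z : nat)%:R
      * (e ^+ b) ^ (half_srank false x - d))%R.
  by rewrite -mulr_suml (root_orthogonality _ wp) stcrankP.
have inner2 (x : intpartn N) : (\sum_(b < 2) (e ^+ b) ^ (half_srank false x - d) =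
    2%:R * ((srank x == i%:Z %[mod 4])%Z : nat)%:R)%R.
  by rewrite (root_orthogonality _ ep) srankP.
have vanish (j : 'I_5) (b : 'I_2) : j != ord0 -> (\sum_(x : intpartn N) term j b x = 0)%R.
  move=> j0; have w0 := prim_root_neq0 wp; have e0 := prim_root_neq0 ep.
  have wj1 : (w ^+ j != 1)%R.
    by rewrite -(prim_order_dvd wp) gtnNdvd // lt0n.
  have wj5 : ((w ^+ j) ^+ 5 = 1)%R by rewrite exprAC (prim_expr_order wp) expr1n.
  have eb2 : ((e ^+ b) ^+ 2 = 1)%R by rewrite exprAC (prim_expr_order ep) expr1n.
  have /(congr1 (fun y => (w ^+ j) ^ (- Posz k) * (e ^+ b) ^ (- d) * y)%R) := stcrank_sum n wj5 wj1 eb2.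
  rewrite mulr0 mulr_sumr => S0; rewrite -[RHS]S0; apply: eq_bigr => x _.
  by rewrite /term !exprzDr ?unitfE ?expf_neq0 //; ring.
have cards : (\sum_(x : intpartn N) \sum_(b < 2) \sum_(j < 5) term j b x
        = \sum_(x : intpartn N) \sum_(b < 2) term ord0 b x)%R.
  rewrite exchange_big [RHS]exchange_big; apply: eq_bigr => b _.
  rewrite exchange_big big_ord_recl /= [X in (_ + X)%R]big1 ?addr0 // => j _.
  exact: vanish.
apply/eqP; rewrite -(eqn_pmul2l (isT : 0 < 2)) -(Num.Theory.eqr_nat algC); apply/eqP.
rewrite !natrM /p_srank -!sum1_card !natr_sum.
rewrite [in LHS]big_mkcond [in RHS]big_mkcond !mulr_sumr.
transitivity (\sum_(x : intpartn N) \sum_(b < 2) \sum_(j < 5) term j b x)%R.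
  apply: eq_bigr => x _; under eq_bigr => b _ do rewrite inner5.
  rewrite -mulr_sumr inner2 inE.
  by do 2!case: (_ == _); rewrite /= ?mulr0 ?mul0r ?mulr0 //; ring.
rewrite cards; apply: eq_bigr => x _; rewrite inE.
rewrite (eq_bigr (fun b : 'I_2 => (e ^+ b) ^ (half_srank false x - d))%R); last first.
  by move=> b _; rewrite /term expr0 exp1rz mul1r.
by rewrite inner2; case: (_ == _).
Qed.
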